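(* Consider the initial-boundary value problem $$\frac{\partial w}{\partial t}(t,x) + v(t,x)\frac{\partial w}{\partial x}(t,x) = 0, \quad \text{for } t\ge 0,\ x\in[0,1],$$ $$w(0,x)=\varphi(x), \quad \text{for } x\in[0,1],$$ $$w(t,0)=a(t), \quad \text{for } t\ge 0,$$ where $\varphi\in W^{2,\infty}([0,1])$, $a\in W^{2,\infty}([0,T])$ for every $T>0$, with $a(0)=\varphi(0)$, $\dot a(0)+v(0,0)\varphi'(0)=0$, and $v\in C^1(\mathbb{R}_+\times[0,1])$ is a non-negative function (i.e., $v(t,x)\ge 0$ for all $t\ge 0$, $x\in[0,1]$) which has Lipschitz derivatives on $[0,T]\times[0,1]$ for every $T>0$. Assume that $v(t,0)>0$ for all $t\ge 0$. Then the initial-boundary value problem has a unique solution $w\in C^1(\mathbb{R}_+\times[0,1])$, which has Lipschitz derivatives on $[0,T]\times[0,1]$ for every $T>0$ and satisfies the inequality $$\|w[t]\|_\infty \le \max\Big(\max_{0\le s\le t}(|a(s)|),\ \|\varphi\|_\infty\Big), \quad \text{for all } t\ge 0.$$ Moreover, if there exists a constant $v_{\min}>0$ such that $v(t,x)\ge v_{\min}$ for all $t\ge 0$, $x\in[0,1]$ and if $a\equiv 0$, then $w(t,x)=0$ for all $x\in[0,1]$ and $t\ge v_{\min}^{-1}$.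
   Context: $\mathbb{R}_+ := [0,+\infty)$. For a compact interval $I$, $W^{2,\infty}(I)$ is the space of $C^1$ functions on $I$ with Lipschitz derivative. $C^1(\mathbb{R}_+\times[0,1])$ is the class of real-valued continuously differentiable functions on $\mathbb{R}_+\times[0,1]$ (including the boundary). $w[t]$ denotes the profile at time $t$: $(w[t])(x)=w(t,x)$ for $x\in[0,1]$; for a bounded function $w:[0,1]\to\mathbb{R}$, $\|w\|_\infty := \sup_{0\le x\le 1}|w(x)|$. *)

(* Defs.v *)
From Stdlib Require Import Reals.
From Coquelicot Require Import Coquelicot.
Open Scope R_scope.

Definition seg (a b : R) : R -> Prop := fun x => a <= x <= b.

Definition half_line : R -> Prop := fun t => 0 <= t.

(* Points of the plane are pairs (t, x): time first, then space. *)
Definition half_strip : R * R -> Prop := fun p => 0 <= fst p /\ 0 <= snd p <= 1.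

Definition rect (T : R) : R * R -> Prop :=
  fun p => 0 <= fst p <= T /\ 0 <= snd p <= 1.

(* Functions are total, but only their values on the domain D count: all
   derivatives and limits are relative to D, hence one-sided at the boundary.
   On the sets used here the relative derivatives are unique. *)
Definition is_derive_within (D : R -> Prop) (f : R -> R) (x l : R) : Prop :=
  filterdiff f (within D (locally x)) (fun h : R => scal h l).

Definition is_grad_within (D : R * R -> Prop) (f : R * R -> R)
    (p : R * R) (lt lx : R) : Prop :=
  filterdiff f (within D (locally p))
    (fun h : R * R => fst h * lt + snd h * lx).

Definition lipschitz_on {U : NormedModule R_AbsRing} (D : U -> Prop)
    (f : U -> R) : Prop :=
  exists L : R, forall p q : U, D p -> D q ->
    Rabs (f p - f q) <= L * norm (minus p q).

Definition W2inf (a b : R) (f : R -> R) : Prop :=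
  exists df : R -> R,
    (forall x, seg a b x -> is_derive_within (seg a b) f x (df x)) /\
    continuous_on (seg a b) df /\
    lipschitz_on (seg a b) df.

(* f is C^1 on the half-strip, with partial derivatives ft and fx. *)
Definition C1_with (f ft fx : R * R -> R) : Prop :=
  (forall p, half_strip p -> is_grad_within half_strip f p (ft p) (fx p)) /\
  continuous_on half_strip ft /\
  continuous_on half_strip fx.

Definition C1_loc_lipschitz (f : R * R -> R) : Prop :=
  exists ft fx : R * R -> R,
    C1_with f ft fx /\
    forall T, 0 < T -> lipschitz_on (rect T) ft /\ lipschitz_on (rect T) fx.

Definition C1_solution (v : R * R -> R) (phi a : R -> R)
    (w : R * R -> R) : Prop :=
  (exists wt wx : R * R -> R,
    C1_with w wt wx /\
    forall t x, 0 <= t -> 0 <= x <= 1 -> wt (t, x) + v (t, x) * wx (t, x) = 0) /\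
  (forall x, 0 <= x <= 1 -> w (0, x) = phi x) /\
  (forall t, 0 <= t -> w (t, 0) = a t).

(* Supremum of |f| over [a, b]. It is meaningful for f bounded on a nonempty
   [a, b]; it is only applied to functions continuous on [a, b], for
   which it is also the maximum of |f|. *)
Definition sup_abs (a b : R) (f : R -> R) : R :=
  real (Lub_Rbar (fun y => exists x, seg a b x /\ y = Rabs (f x))).

(* Main.v *)
(** The key is a first integral [z] of the characteristics on [0, T] x [0, 1]: a
    function with [z_t + v z_x = 0], [z_x > 0] and [z (0, x) = x].  It is obtained
    by extending [v] in [x] to the whole line and following the flow of
    [x' = v (t, x)] back to time 0; its values on the inflow boundary [x = 0] are
    whatever this extension produces.  As [b t = z (t, 0)] is strictly
    decreasing, [w = h o z] solves the problem when [h = phi] on [0, 1] and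
    [h = a o b^-1] on [b T, 0], and the two compatibility conditions say exactly
    that [h] is C^1 at 0.  Since [b t <= z (t, x) <= x], every value of [w] is a
    value of [a] or of [phi], which gives the sup bound; if [v >= vmin], then [z]
    decreases along the rays [x = vmin (t - s)], so that [z <= 0] for
    [t >= 1 / vmin].  Uniqueness is a maximum principle, which needs only
    [v >= 0], and it also makes the solutions for different [T] agree.

    "C^1 with Lipschitz derivative" is handled throughout as a first-order
    Taylor expansion with uniform quadratic remainder. *)

Require Import Defs.
From Stdlib Require Import Reals Lra Psatz Classical IndefiniteDescription.
From Coquelicot Require Import Coquelicot.
Open Scope R_scope.

(** * Relative derivatives and Taylor expansions *)

(** The obstacle is that a backward characteristic may leave the strip through [x = 0] before time
    0, where [v] has no values. Extending [v] avoids a study of how the exit time depends on the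
    point: the extended flow always reaches time 0, and the inverse of [b] then recovers the time at
    which the characteristic entered. The extended field need not be nonnegative; the signs of [v]
    enter only through [z_t = - v z_x] inside the strip. As [v] may vanish for [x > 0],
    characteristics cannot be parametrised by [x], so time remains the parameter.

    Quadratic expansions pay off because composing, inverting and gluing become algebra on
    inequalities, the same at boundary points as inside, and because the Lipschitz bound on the
    derivative comes out of the same inequality. Uniqueness cannot rest on them, since a competing
    solution is merely C^1; hence a maximum principle that works with relative gradients at single
    points. *)

Definition clamp (a b x : R) : R := Rmax a (Rmin b x).

Lemma clamp_seg a b x : a <= b -> seg a b (clamp a b x).
Proof. unfold seg, clamp, Rmax, Rmin; repeat destruct Rle_dec; lra. Qed.

Lemma clamp_id a b x : seg a b x -> clamp a b x = x.
Proof. unfold seg, clamp, Rmax, Rmin; repeat destruct Rle_dec; lra. Qed.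

Lemma clamp_lipschitz a b x y : Rabs (clamp a b y - clamp a b x) <= Rabs (y - x).
Proof.
unfold clamp, Rmax, Rmin; repeat destruct Rle_dec;
  unfold Rabs; repeat destruct Rcase_abs; lra.
Qed.

Lemma clamp_rest_lipschitz a b x y : a <= b ->
  Rabs ((y - clamp a b y) - (x - clamp a b x)) <= Rabs (y - x).
Proof.
intros Hab; unfold clamp, Rmax, Rmin; repeat destruct Rle_dec;
  unfold Rabs; repeat destruct Rcase_abs; lra.
Qed.

(** [filterdiff] quantifies over all limit points of the filter. As [x] itself lies in [D], every
    neighbourhood of a limit point contains [x], so [x] is the only one. *)
Lemma filterdiff_within_iff {U : NormedModule R_AbsRing} (D : U -> Prop)
    (f l : U -> R) (x : U) : D x -> is_linear l ->
  filterdiff f (within D (locally x)) l <->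
  (forall eps, 0 < eps -> exists d : posreal, forall y, D y -> ball x d y ->
     Rabs (f y - f x - l (minus y x)) <= eps * norm (minus y x)).
Proof.
intros Dx Hl; split.
- intros [_ H] eps Heps.
  assert (Hlim : is_filter_lim (within D (locally x)) x).
  { intros P [d Hd]; exists d; intros y Hy _; exact (Hd y Hy). }
  destruct (H x Hlim (mkposreal eps Heps)) as [d Hd].
  exists d; intros y Dy Hy; exact (Hd y Hy Dy).
- intros H; split; [exact Hl|]; intros x0 Hx0.
  assert (E : x0 = x).
  { apply (eq_close x0 x); intros eps.
    destruct (Hx0 (ball x0 eps)) as [d Hd]; [now exists eps|].
    apply (Hd x); [apply ball_center|exact Dx]. }
  subst x0; intros eps.
  destruct (H eps (cond_pos eps)) as [d Hd].
  exists d; intros y Hy Dy; exact (Hd y Dy Hy).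
Qed.

Lemma is_derive_within_iff D h x l : D x ->
  is_derive_within D h x l <->
  (forall eps, 0 < eps -> exists d, 0 < d /\ forall y, D y -> Rabs (y - x) < d ->
     Rabs (h y - h x - l * (y - x)) <= eps * Rabs (y - x)).
Proof.
intros Dx; unfold is_derive_within.
rewrite (filterdiff_within_iff (U := R_NormedModule) D h (fun k : R => scal k l) x Dx);
  [|exact (is_linear_scal_l (K := R_AbsRing) (V := R_NormedModule) l)].
split; intros H eps Heps; destruct (H eps Heps) as [d Hd].
- exists d; split; [apply cond_pos|]; intros y Dy Hy.
  rewrite (Rmult_comm l); exact (Hd y Dy Hy).
- destruct Hd as [Hd0 Hd]; exists (mkposreal d Hd0); intros y Dy Hy.
  generalize (Hd y Dy Hy); rewrite (Rmult_comm l); auto.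
Qed.

Lemma norm_pair_le (h : R * R) :
  norm h <= Rabs (fst h) + Rabs (snd h).
Proof.
change (sqrt (Rabs (fst h) ^ 2 + Rabs (snd h) ^ 2) <= Rabs (fst h) + Rabs (snd h)).
generalize (Rabs_pos (fst h)) (Rabs_pos (snd h)); intros H1 H2.
apply Rsqr_incr_0_var; [|lra]; rewrite Rsqr_sqrt; unfold Rsqr; nra.
Qed.

Lemma norm_pair_ge (h : R * R) :
  Rabs (fst h) <= norm h /\ Rabs (snd h) <= norm h.
Proof.
change (Rabs (fst h) <= sqrt (Rabs (fst h) ^ 2 + Rabs (snd h) ^ 2) /\
        Rabs (snd h) <= sqrt (Rabs (fst h) ^ 2 + Rabs (snd h) ^ 2)).
generalize (Rabs_pos (fst h)) (Rabs_pos (snd h)); intros H1 H2.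
split; apply Rsqr_incr_0_var; try apply sqrt_pos;
  rewrite Rsqr_sqrt; unfold Rsqr; nra.
Qed.

Lemma is_linear_grad (lt lx : R) :
  is_linear (U := prod_NormedModule _ R_NormedModule R_NormedModule)
    (fun h : R * R => fst h * lt + snd h * lx).
Proof.
split.
- intros x y.
  change ((fst x + fst y) * lt + (snd x + snd y) * lx =
    (fst x * lt + snd x * lx) + (fst y * lt + snd y * lx)); ring.
- intros k x.
  change ((k * fst x) * lt + (k * snd x) * lx = k * (fst x * lt + snd x * lx)); ring.
- exists (Rabs lt + Rabs lx + 1).
  generalize (Rabs_pos lt) (Rabs_pos lx); intros H1 H2; split; [lra|]; intros [p q].
  destruct (norm_pair_ge (p, q)) as [G1 G2]; simpl fst in *; simpl snd in *.
  match goal with |- _ <= _ * ?n => set (N := n) in * end.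
  change (Rabs p <= N) in G1; change (Rabs q <= N) in G2.
  change (Rabs (p * lt + q * lx) <= (Rabs lt + Rabs lx + 1) * N).
  generalize (Rabs_pos p) (Rabs_pos q); intros H3 H4.
  eapply Rle_trans; [apply Rabs_triang|]; rewrite !Rabs_mult; nra.
Qed.

Lemma is_grad_within_iff D f t x lt lx : D (t, x) ->
  is_grad_within D f (t, x) lt lx <->
  (forall eps, 0 < eps -> exists d, 0 < d /\ forall t' x', D (t', x') ->
     Rabs (t' - t) < d -> Rabs (x' - x) < d ->
     Rabs (f (t', x') - f (t, x) - ((t' - t) * lt + (x' - x) * lx))
       <= eps * (Rabs (t' - t) + Rabs (x' - x))).
Proof.
intros Dx; unfold is_grad_within.
rewrite (filterdiff_within_iff (U := prod_NormedModule _ R_NormedModule R_NormedModule)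
  D f _ (t, x) Dx (is_linear_grad lt lx)).
split; intros H eps Heps.
- destruct (H eps Heps) as [d Hd].
  exists d; split; [apply cond_pos|]; intros t' x' Dy Ht Hx.
  eapply Rle_trans; [apply (Hd (t', x') Dy); split; assumption|].
  apply Rmult_le_compat_l; [lra|].
  exact (norm_pair_le (t' - t, x' - x)).
- destruct (H (eps / 2) ltac:(lra)) as [d [Hd0 Hd]].
  exists (mkposreal d Hd0); intros [t' x'] Dy [Ht Hx].
  eapply Rle_trans; [apply (Hd t' x' Dy Ht Hx)|].
  destruct (norm_pair_ge (t' - t, x' - x)) as [G1 G2]; simpl in G1, G2.
  change (@minus _ (t', x') (t, x)) with (t' - t, x' - x).
  match goal with |- _ <= _ * ?n => set (N := n) in * end.
  change (Rabs (t' - t) <= N) in G1; change (Rabs (x' - x) <= N) in G2.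
  nra.
Qed.

Lemma lipschitz_on_pair_iff D f :
  lipschitz_on (U := prod_NormedModule _ R_NormedModule R_NormedModule) D f <->
  exists L, 0 <= L /\ forall t x t' x', D (t, x) -> D (t', x') ->
    Rabs (f (t', x') - f (t, x)) <= L * (Rabs (t' - t) + Rabs (x' - x)).
Proof.
split.
- intros [L H]; exists (Rabs L); split; [apply Rabs_pos|]; intros t x t' x' D1 D2.
  eapply Rle_trans; [apply (H (t', x') (t, x) D2 D1)|].
  generalize (norm_pair_le (t' - t, x' - x)); simpl; intros G.
  change (@minus _ (t', x') (t, x)) with (t' - t, x' - x).
  match goal with |- _ * ?n <= _ => set (N := n) in * end.
  change (N <= Rabs (t' - t) + Rabs (x' - x)) in G.
  assert (0 <= N) by apply norm_ge_0.
  generalize (Rle_abs L) (Rabs_pos L); nra.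
- intros [L [L0 H]]; exists (2 * L); intros [t' x'] [t x] D2 D1.
  eapply Rle_trans; [apply (H t x t' x' D1 D2)|].
  destruct (norm_pair_ge (t' - t, x' - x)) as [G1 G2]; simpl in G1, G2.
  change (@minus _ (t', x') (t, x)) with (t' - t, x' - x).
  match goal with |- _ <= _ * ?n => set (N := n) in * end.
  change (Rabs (t' - t) <= N) in G1; change (Rabs (x' - x) <= N) in G2.
  nra.
Qed.

Lemma lipschitz_continuous (h : R -> R) (L : R) :
  (forall x y, Rabs (h y - h x) <= L * Rabs (y - x)) -> forall x, continuous h x.
Proof.
intros H x; apply continuity_pt_filterlim; intros eps Heps.
assert (HL : 0 < Rabs L + 1) by (generalize (Rabs_pos L); lra).
exists (eps / (Rabs L + 1)); split; [now apply Rdiv_lt_0_compat|].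
intros y [_ Hy]; simpl in *; unfold Rdist in *.
eapply Rle_lt_trans; [apply H|].
apply Rle_lt_trans with ((Rabs L + 1) * Rabs (y - x)).
- generalize (Rle_abs L) (Rabs_pos (y - x)); nra.
- replace eps with ((Rabs L + 1) * (eps / (Rabs L + 1))) by (field; lra).
  apply Rmult_lt_compat_l; assumption.
Qed.

Lemma MVT_seg a b h dh :
  (forall x, seg a b x -> is_derive_within (seg a b) h x (dh x)) ->
  forall x y, seg a b x -> seg a b y -> exists c,
    Rmin x y <= c <= Rmax x y /\ h y - h x = dh c * (y - x).
Proof.
intros H x y Hx Hy.
assert (Hab : a <= b) by (unfold seg in Hx; lra).
destruct (Req_dec x y) as [<-|Hxy].
{ exists x; split; [|ring]; rewrite Rmin_left, Rmax_left; lra. }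
(* The classical mean value theorem wants two-sided continuity at the endpoints, where [h] is
   controlled from one side only; composing with [clamp] supplies it and changes nothing on the
   segment. *)
set (k := fun z => h (clamp a b z)).
assert (Hseg : forall z, Rmin x y <= z <= Rmax x y -> seg a b z).
{ intros z; unfold seg in *; generalize (Rmin_l x y) (Rmin_r x y) (Rmax_l x y) (Rmax_r x y);
  unfold Rmin, Rmax; destruct Rle_dec; lra. }
destruct (MVT_gen k x y dh) as [c [Hc E]].
- intros z Hz.
  assert (Hz' : Rmin x y <= z <= Rmax x y) by lra.
  generalize (proj1 (is_derive_within_iff _ _ _ _ (Hseg z Hz')) (H z (Hseg z Hz'))).
  intros Hd; split; [exact (is_linear_scal_l (K := R_AbsRing) (V := R_NormedModule) _)|].
  intros z0 Hz0.
  apply (is_filter_lim_locally_unique (K := R_AbsRing) (V := AbsRing_NormedModule R_AbsRing)) in Hz0.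
  subst z0; intros eps.
  destruct (Hd eps (cond_pos eps)) as [d [Hd0 Hdd]].
  assert (Hr : 0 < Rmin d (Rmin (z - Rmin x y) (Rmax x y - z)))
    by (repeat apply Rmin_glb_lt; lra).
  exists (mkposreal _ Hr); intros z' Hz1.
  change (Rabs (z' - z) < Rmin d (Rmin (z - Rmin x y) (Rmax x y - z))) in Hz1.
  generalize (Rmin_l d (Rmin (z - Rmin x y) (Rmax x y - z)))
    (Rmin_r d (Rmin (z - Rmin x y) (Rmax x y - z)))
    (Rmin_l (z - Rmin x y) (Rmax x y - z)) (Rmin_r (z - Rmin x y) (Rmax x y - z)); intros R1 R2 R3 R4.
  assert (Hz2 : seg a b z').
  { apply Hseg; apply Rabs_def2 in Hz1; lra. }
  generalize (Hdd z' Hz2 ltac:(lra)).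
  unfold k; rewrite !clamp_id by auto.
  rewrite (Rmult_comm (dh z)); auto.
- intros z Hz eps Heps.
  generalize (proj1 (is_derive_within_iff _ _ _ _ (Hseg z Hz)) (H z (Hseg z Hz)) 1 Rlt_0_1).
  intros [d [Hd0 Hd]].
  assert (HL : 0 < Rabs (dh z) + 1) by (generalize (Rabs_pos (dh z)); lra).
  exists (Rmin d (eps / (Rabs (dh z) + 1))); split.
  { apply Rmin_glb_lt; [lra|now apply Rdiv_lt_0_compat]. }
  intros z' [_ Hz']; simpl in *; unfold Rdist in *.
  assert (G1 : Rabs (clamp a b z' - z) <= Rabs (z' - z)).
  { rewrite <- (clamp_id a b z) at 1 by auto; apply clamp_lipschitz. }
  generalize (Rmin_l d (eps / (Rabs (dh z) + 1))) (Rmin_r d (eps / (Rabs (dh z) + 1))); intros R1 R2.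
  generalize (Hd _ (clamp_seg a b z' Hab) ltac:(lra)); intros G2.
  unfold k; rewrite (clamp_id a b z) by auto.
  set (w := clamp a b z') in *.
  apply Rle_lt_trans with ((Rabs (dh z) + 1) * Rabs (z' - z)).
  + apply Rle_trans with (Rabs (h w - h z - dh z * (w - z)) + Rabs (dh z * (w - z))).
    * replace (h w - h z) with ((h w - h z - dh z * (w - z)) + dh z * (w - z)) at 1 by ring.
      apply Rabs_triang.
    * rewrite Rabs_mult; generalize (Rabs_pos (dh z)) (Rabs_pos (w - z)); nra.
  + apply Rlt_le_trans with ((Rabs (dh z) + 1) * (eps / (Rabs (dh z) + 1))).
    * apply Rmult_lt_compat_l; lra.
    * right; field; lra.
- exists c; split; [exact Hc|].
  unfold k in E; rewrite !clamp_id in E by auto; exact E.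
Qed.

(** No limit is involved, so the property restricts to subsets at once; [derive_of_taylor] and
    [taylor_lipschitz] recover the derivative and its Lipschitz bound. *)
Definition taylor (D : R -> Prop) (h dh : R -> R) (C : R) : Prop :=
  forall x y, D x -> D y -> Rabs (h y - h x - dh x * (y - x)) <= C * (y - x) ^ 2.

Lemma taylor_weaken (D : R -> Prop) h dh C C' : C <= C' -> taylor D h dh C -> taylor D h dh C'.
Proof.
intros HC H x y Dx Dy; eapply Rle_trans; [now apply H|].
apply Rmult_le_compat_r; [apply pow2_ge_0|exact HC].
Qed.

Lemma taylor_of_derive a b h dh L :
  (forall x, seg a b x -> is_derive_within (seg a b) h x (dh x)) ->
  (forall x y, seg a b x -> seg a b y -> Rabs (dh y - dh x) <= L * Rabs (y - x)) ->
  taylor (seg a b) h dh L.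
Proof.
intros H HL x y Dx Dy.
destruct (MVT_seg a b h dh H x y Dx Dy) as [c [Hc E]].
rewrite E, <- Rmult_minus_distr_r, Rabs_mult.
assert (Hseg : seg a b c).
{ revert Hc; unfold seg in *; unfold Rmin, Rmax; destruct Rle_dec; lra. }
assert (Hcx : Rabs (c - x) <= Rabs (y - x)).
{ revert Hc; unfold Rmin, Rmax; destruct Rle_dec; unfold Rabs; repeat destruct Rcase_abs; lra. }
destruct (Req_dec x y) as [<-|Hne].
{ rewrite Rminus_diag, Rabs_R0; simpl; lra. }
assert (Hp : 0 < Rabs (y - x)) by (apply Rabs_pos_lt; lra).
assert (L0 : 0 <= L).
{ generalize (HL x y Dx Dy) (Rabs_pos (dh y - dh x)); nra. }
rewrite <- pow2_abs; simpl; rewrite Rmult_1_r, <- Rmult_assoc.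
apply Rmult_le_compat_r; [apply Rabs_pos|].
eapply Rle_trans; [exact (HL x c Dx Hseg)|]; now apply Rmult_le_compat_l.
Qed.

Lemma derive_of_taylor D h dh C x : D x -> taylor D h dh C -> is_derive_within D h x (dh x).
Proof.
intros Dx H; apply is_derive_within_iff; [exact Dx|]; intros eps Heps.
assert (HL : 0 < Rabs C + 1) by (generalize (Rabs_pos C); lra).
exists (eps / (Rabs C + 1)); split; [now apply Rdiv_lt_0_compat|].
intros y Dy Hy; eapply Rle_trans; [now apply H|].
rewrite <- pow2_abs.
assert (G : (Rabs C + 1) * Rabs (y - x) <= eps).
{ replace eps with ((Rabs C + 1) * (eps / (Rabs C + 1))) by (field; lra).
  apply Rmult_le_compat_l; lra. }
generalize (Rle_abs C) (Rabs_pos (y - x)); intros G1 G2.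
assert (C * Rabs (y - x) <= eps) by nra.
nra.
Qed.

(** In the sum of the expansion at [x] and the one at [y] the values of [h] cancel, which leaves the
    difference of the slopes times [y - x]. *)
Lemma taylor_lipschitz D h dh C x y : taylor D h dh C -> D x -> D y ->
  Rabs (dh y - dh x) <= 2 * C * Rabs (y - x).
Proof.
intros H Dx Dy; destruct (Req_dec x y) as [<-|Hne].
{ rewrite !Rminus_diag, Rabs_R0; lra. }
assert (Hp : 0 < Rabs (y - x)) by (apply Rabs_pos_lt; lra).
apply Rmult_le_reg_r with (Rabs (y - x)); [exact Hp|].
rewrite <- Rabs_mult.
replace ((dh y - dh x) * (y - x)) with
  ((h y - h x - dh x * (y - x)) + (h x - h y - dh y * (x - y))) by ring.
eapply Rle_trans; [apply Rabs_triang|].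
generalize (H x y Dx Dy) (H y x Dy Dx).
replace (2 * C * Rabs (y - x) * Rabs (y - x)) with (2 * C * Rabs (y - x) ^ 2) by ring.
rewrite pow2_abs; replace ((x - y) ^ 2) with ((y - x) ^ 2) by ring; lra.
Qed.

(** That the slopes match at [m] is hidden in the use of one [dh] on both sides. Between points on
    opposite sides, expand from [x] to [m] and from [m] to [y]; replacing the slope at [m] by the
    one at [x] costs a product of the two distances, by [taylor_lipschitz]. *)
Lemma taylor_glue D h dh C m : 0 <= C -> D m ->
  taylor (fun x => D x /\ x <= m) h dh C -> taylor (fun x => D x /\ m <= x) h dh C ->
  taylor D h dh (3 * C).
Proof.
intros C0 Dm Hl Hr.
assert (Key : forall (P Q : R -> Prop), P m -> Q m -> taylor P h dh C -> taylor Q h dh C ->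
  forall x y, P x -> Q y -> Rabs (m - x) + Rabs (y - m) <= Rabs (y - x) ->
  Rabs (h y - h x - dh x * (y - x)) <= 3 * C * (y - x) ^ 2).
{ intros P Q Pm Qm HP HQ x y Px Qy Hd.
  replace (h y - h x - dh x * (y - x)) with
    ((h y - h m - dh m * (y - m)) + (h m - h x - dh x * (m - x)) + (dh m - dh x) * (y - m)) by ring.
  eapply Rle_trans; [apply Rabs_triang|].
  eapply Rle_trans; [apply Rplus_le_compat_r, Rabs_triang|].
  rewrite Rabs_mult.
  generalize (HP x m Px Pm) (HQ m y Qm Qy) (taylor_lipschitz P h dh C x m HP Px Pm).
  rewrite <- (pow2_abs (m - x)), <- (pow2_abs (y - m)), <- (pow2_abs (y - x)).
  generalize (Rabs_pos (m - x)) (Rabs_pos (y - m)) Hd.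
  generalize (Rabs (m - x)) (Rabs (y - m)) (Rabs (y - x)); intros p q r Hp Hq Hpq H1 H2 H3.
  assert (Rabs (dh m - dh x) * q <= 2 * C * p * q) by (apply Rmult_le_compat_r; assumption).
  assert (C * (p + q) ^ 2 <= C * r ^ 2).
  { apply Rmult_le_compat_l; [assumption|]; apply pow_incr; lra. }
  assert (0 <= C * r ^ 2) by (apply Rmult_le_pos; [assumption|apply pow2_ge_0]).
  nra. }
intros x y Dx Dy.
destruct (Rle_dec x m) as [Hx|Hx]; destruct (Rle_dec y m) as [Hy|Hy].
- apply (taylor_weaken _ _ _ C (3 * C) ltac:(lra) Hl); auto.
- apply (Key _ _ (conj Dm (Rle_refl m)) (conj Dm (Rle_refl m)) Hl Hr); [auto|split;[auto|lra]|].
  unfold Rabs; repeat destruct Rcase_abs; lra.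
- apply (Key _ _ (conj Dm (Rle_refl m)) (conj Dm (Rle_refl m)) Hr Hl); [split;[auto|lra]|auto|].
  unfold Rabs; repeat destruct Rcase_abs; lra.
- apply (taylor_weaken _ _ _ C (3 * C) ltac:(lra) Hr); split; auto; lra.
Qed.

Lemma is_derive_within_unique D h x l l' : D x ->
  (forall d, 0 < d -> exists y, D y /\ 0 < Rabs (y - x) < d) ->
  is_derive_within D h x l -> is_derive_within D h x l' -> l = l'.
Proof.
intros Dx Hacc H H'.
rewrite is_derive_within_iff in H, H' by exact Dx.
destruct (Req_dec l l') as [|Hne]; [assumption|exfalso].
assert (Hp : 0 < Rabs (l - l')) by (apply Rabs_pos_lt; lra).
destruct (H (Rabs (l - l') / 4) ltac:(lra)) as [d [Hd0 Hd]].
destruct (H' (Rabs (l - l') / 4) ltac:(lra)) as [d' [Hd0' Hd']].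
destruct (Hacc (Rmin d d') ltac:(now apply Rmin_glb_lt)) as [y [Dy [Hy0 Hy]]].
generalize (Rmin_l d d') (Rmin_r d d'); intros R1 R2.
generalize (Hd y Dy ltac:(lra)) (Hd' y Dy ltac:(lra)); intros G G'.
assert (E : Rabs (l - l') * Rabs (y - x) <= Rabs (l - l') / 2 * Rabs (y - x)).
{ rewrite <- Rabs_mult.
  replace ((l - l') * (y - x)) with
    ((h y - h x - l' * (y - x)) + - (h y - h x - l * (y - x))) by ring.
  eapply Rle_trans; [apply Rabs_triang|]; rewrite Rabs_Ropp; lra. }
nra.
Qed.

Lemma is_derive_within_subset (D D' : R -> Prop) h x l : D' x -> (forall y, D' y -> D y) ->
  is_derive_within D h x l -> is_derive_within D' h x l.
Proof.
intros Dx HD H; rewrite is_derive_within_iff in H by auto.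
apply is_derive_within_iff; [exact Dx|]; intros eps Heps.
destruct (H eps Heps) as [d [Hd0 Hd]]; exists d; split; [exact Hd0|]; auto.
Qed.

Lemma is_derive_within_of_is_derive (D : R -> Prop) h x l : D x ->
  is_derive h x l -> is_derive_within D h x l.
Proof.
intros Dx [_ H]; apply is_derive_within_iff; [exact Dx|]; intros eps Heps.
destruct (H x (fun P HP => HP) (mkposreal eps Heps)) as [d Hd].
exists d; split; [apply cond_pos|]; intros y _ Hy.
rewrite (Rmult_comm l); exact (Hd y Hy).
Qed.

Lemma is_derive_increment_bound h dh M a b :
  (forall x, Rmin a b <= x <= Rmax a b -> is_derive h x (dh x)) ->
  (forall x, Rmin a b <= x <= Rmax a b -> Rabs (dh x) <= M) ->
  Rabs (h b - h a) <= M * Rabs (b - a).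
Proof.
intros H HM; destruct (MVT_gen h a b dh) as [c [Hc E]].
- intros x Hx; apply H; lra.
- intros x Hx; apply derivable_continuous_pt; exists (dh x).
  now apply is_derive_Reals, H.
- rewrite E, Rabs_mult; apply Rmult_le_compat_r; [apply Rabs_pos|auto].
Qed.

(** * Bounded extension from a segment to the whole line *)

Lemma sin_lipschitz x y : Rabs (sin y - sin x) <= Rabs (y - x).
Proof.
rewrite <- (Rmult_1_l (Rabs (y - x))).
apply (is_derive_increment_bound sin cos).
- intros z _; apply is_derive_Reals, derivable_pt_lim_sin.
- intros z _; apply Rabs_le; generalize (COS_bound z); lra.
Qed.

Lemma cos_lipschitz x y : Rabs (cos y - cos x) <= Rabs (y - x).
Proof.
rewrite <- (Rmult_1_l (Rabs (y - x))).
apply (is_derive_increment_bound cos (fun z => - sin z)).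
- intros z _; apply is_derive_Reals, derivable_pt_lim_cos.
- intros z _; apply Rabs_le; generalize (SIN_bound z); lra.
Qed.

Lemma sin_taylor D : taylor D sin cos 1.
Proof.
intros x y _ _.
apply (taylor_of_derive (Rmin x y) (Rmax x y)).
- intros z Hz; apply is_derive_within_of_is_derive; [exact Hz|].
  apply is_derive_Reals, derivable_pt_lim_sin.
- intros u z _ _; rewrite Rmult_1_l; apply cos_lipschitz.
- split; [apply Rmin_l|apply Rmax_l].
- split; [apply Rmin_r|apply Rmax_r].
Qed.

(* Any bounded function with derivative 1 at 0 would do in place of [sin]: it
   keeps the extension bounded, with Lipschitz derivative. *)
Definition ext (a b : R) (h dh : R -> R) (x : R) : R :=
  h (clamp a b x) + dh (clamp a b x) * sin (x - clamp a b x).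

Definition dext (a b : R) (dh : R -> R) (x : R) : R :=
  dh (clamp a b x) * cos (x - clamp a b x).

Lemma ext_id a b h dh x : seg a b x -> ext a b h dh x = h x.
Proof.
intros Hx; unfold ext; rewrite clamp_id by exact Hx.
rewrite Rminus_diag, sin_0; ring.
Qed.

Lemma dext_id a b dh x : seg a b x -> dext a b dh x = dh x.
Proof.
intros Hx; unfold dext; rewrite clamp_id by exact Hx.
rewrite Rminus_diag, cos_0; ring.
Qed.

Lemma dext_bound a b dh C x : a <= b -> (forall x, seg a b x -> Rabs (dh x) <= C) ->
  Rabs (dext a b dh x) <= C.
Proof.
intros Hab HB; unfold dext; rewrite Rabs_mult.
generalize (HB _ (clamp_seg a b x Hab)) (Rabs_pos (dh (clamp a b x))); intros H1 H2.
assert (Rabs (cos (x - clamp a b x)) <= 1) by (apply Rabs_le; generalize (COS_bound (x - clamp a b x)); lra).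
generalize (Rabs_pos (cos (x - clamp a b x))); nra.
Qed.

(** Two gluings, at [a] and at [b], each cost a factor 3. On an outer piece [clamp] is constant, so
    the remainder is that of [sin] times a slope of [h], whence the bound on [dh] by the same
    [C]. *)
Lemma ext_taylor a b h dh C : a <= b -> taylor (seg a b) h dh C ->
  (forall x, seg a b x -> Rabs (dh x) <= C) ->
  taylor (fun _ => True) (ext a b h dh) (dext a b dh) (9 * C).
Proof.
intros Hab HT HB.
assert (C0 : 0 <= C).
{ eapply Rle_trans; [apply Rabs_pos|apply (HB a); unfold seg; lra]. }
assert (Side : forall m (P : R -> Prop), seg a b m -> (forall x, P x -> clamp a b x = m) ->
  taylor P (ext a b h dh) (dext a b dh) C).
{ intros m P Hm HP x y Px Py; unfold ext, dext; rewrite (HP x Px), (HP y Py).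
  replace (h m + dh m * sin (y - m) - (h m + dh m * sin (x - m)) - dh m * cos (x - m) * (y - x))
    with (dh m * (sin (y - m) - sin (x - m) - cos (x - m) * ((y - m) - (x - m)))) by ring.
  rewrite Rabs_mult; generalize (sin_taylor (fun _ => True) (x - m) (y - m) I I) (HB m Hm).
  replace ((y - m - (x - m)) ^ 2) with ((y - x) ^ 2) by ring; rewrite Rmult_1_l.
  intros; apply Rmult_le_compat; try apply Rabs_pos; assumption. }
replace (9 * C) with (3 * (3 * C)) by ring.
apply (taylor_glue _ _ _ (3 * C) a); [lra|exact I| |].
- apply (taylor_weaken _ _ _ C (3 * C) ltac:(lra)).
  apply (Side a); [unfold seg; lra|]; intros x [_ Hx].
  unfold clamp, Rmax, Rmin; repeat destruct Rle_dec; lra.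
- apply (taylor_glue _ _ _ C b C0); [split; [exact I|lra]| |].
  + intros x y [[_ Hx] Hxb] [[_ Hy] Hyb].
    assert (Sx : seg a b x) by (split; assumption); assert (Sy : seg a b y) by (split; assumption).
    rewrite !ext_id, dext_id by assumption; now apply HT.
  + apply (Side b); [unfold seg; lra|]; intros x [_ Hx].
    unfold clamp, Rmax, Rmin; repeat destruct Rle_dec; lra.
Qed.

(** * The flow of a bounded Lipschitz field *)

Lemma ex_RInt_continuous_all (u : R -> R) a b : (forall r, continuous u r) -> ex_RInt u a b.
Proof. intros H; apply (ex_RInt_continuous (V := R_CompleteNormedModule)); auto. Qed.

Lemma RInt_difference (u w : R -> R) a b :
  (forall r, continuous u r) -> (forall r, continuous w r) ->
  RInt u a b - RInt w a b = RInt (fun r => u r - w r) a b.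
Proof.
intros Hu Hw; symmetry.
apply (RInt_minus (V := R_CompleteNormedModule)); now apply ex_RInt_continuous_all.
Qed.

Lemma RInt_swap_opp (u : R -> R) a b : (forall r, continuous u r) ->
  RInt u a b = - RInt u b a.
Proof.
intros H; symmetry; apply (opp_RInt_swap (V := R_CompleteNormedModule)).
now apply ex_RInt_continuous_all.
Qed.

Lemma plus_minus_cancel (x a b : R) : x + a - (x + b) = a - b.
Proof. ring. Qed.

Lemma RInt_increment (u : R -> R) a b c : (forall r, continuous u r) ->
  RInt u a c - RInt u a b = RInt u b c.
Proof.
intros H.
rewrite <- (RInt_Chasles (V := R_CompleteNormedModule) u a b c)
  by now apply ex_RInt_continuous_all.
unfold plus; simpl; ring.
Qed.

Lemma RInt_bound (u : R -> R) a b M : (forall r, continuous u r) ->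
  (forall r, Rabs (u r) <= M) -> Rabs (RInt u a b) <= M * Rabs (b - a).
Proof.
intros Hc HM.
assert (Key : forall a b, a <= b -> Rabs (RInt u a b) <= M * Rabs (b - a)).
{ clear a b; intros a b Hab; rewrite (Rabs_right (b - a)) by lra; rewrite Rmult_comm.
  apply abs_RInt_le_const; auto; now apply ex_RInt_continuous_all. }
destruct (Rle_dec a b); [now apply Key|].
rewrite RInt_swap_opp, Rabs_Ropp, Rabs_minus_sym by exact Hc; apply Key; lra.
Qed.

(* Integration gains the factor 1 / k in the weighted norm, so that the
   Picard map is a contraction for k = 2 K. *)
Lemma RInt_exp_bound (u : R -> R) t s M k : 0 < k -> 0 <= M -> (forall r, continuous u r) ->
  (forall r, Rabs (u r) <= M * exp (k * Rabs (r - t))) ->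
  Rabs (RInt u t s) <= M / k * exp (k * Rabs (s - t)).
Proof.
intros Hk HM0 Hc HM.
assert (HMk : 0 <= M / k) by (apply Rdiv_le_0_compat; lra).
assert (Key : forall a b e, a <= b -> (forall r, a <= r <= b -> Rabs (u r) <= M * exp (e * (k * (r - t)))) ->
  Rabs e = 1 ->
  Rabs (RInt u a b) <= M / k * (e * exp (e * (k * (b - t))) - e * exp (e * (k * (a - t))))).
{ intros a b e Hab He He1.
  assert (Ee : e * e = 1).
  { revert He1; unfold Rabs; destruct Rcase_abs; nra. }
  set (F := fun r => M / k * (e * exp (e * (k * (r - t))))).
  assert (HF : forall r, is_derive F r (M * exp (e * (k * (r - t))))).
  { intros r; unfold F; auto_derive; [exact I|].
    transitivity (M * (e * e) * exp (e * (k * (r + - t)))); [field; lra|].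
    rewrite Ee; unfold Rminus; ring. }
  assert (Hcw : forall r, continuous (fun r => M * exp (e * (k * (r - t)))) r).
  { intros r; apply (ex_derive_continuous (K := R_AbsRing) (V := R_NormedModule)).
    auto_derive; exact I. }
  eapply Rle_trans; [apply abs_RInt_le; [exact Hab|now apply ex_RInt_continuous_all]|].
  eapply Rle_trans.
  { apply (RInt_le _ (fun r => M * exp (e * (k * (r - t))))); [exact Hab| | |].
    - apply ex_RInt_continuous_all; intros r; apply (continuous_comp u Rabs); [apply Hc|].
      apply continuous_Rabs.
    - now apply ex_RInt_continuous_all.
    - intros r Hr; apply He; lra. }
  right; apply is_RInt_unique.
  replace (M / k * (e * exp (e * (k * (b - t))) - e * exp (e * (k * (a - t))))) with (minus (F b) (F a)).
  - apply (is_RInt_derive (V := R_CompleteNormedModule)); auto.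
  - unfold F, minus, plus, opp; simpl; ring. }
destruct (Rle_dec t s) as [Hts|Hts].
- rewrite (Rabs_right (s - t)) by lra.
  eapply Rle_trans; [apply (Key t s 1 Hts)|].
  + intros r Hr; rewrite Rmult_1_l, <- (Rabs_right (r - t)) by lra; apply HM.
  + apply Rabs_R1.
  + apply Rmult_le_compat_l; [exact HMk|]; rewrite !Rmult_1_l.
    generalize (exp_pos (k * (t - t))); lra.
- rewrite (Rabs_left (s - t)), RInt_swap_opp, Rabs_Ropp by (lra || exact Hc).
  eapply Rle_trans; [apply (Key s t (-1)); [lra| |]|].
  + intros r Hr; replace (-1 * (k * (r - t))) with (k * - (r - t)) by ring.
    rewrite <- Rabs_left1 by lra; apply HM.
  + rewrite Rabs_left; lra.
  + apply Rmult_le_compat_l; [exact HMk|].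
    replace (-1 * (k * (s - t))) with (k * - (s - t)) by ring.
    generalize (exp_pos (-1 * (k * (t - t)))); lra.
Qed.

Definition lip2 (K : R) (f : R -> R -> R) : Prop := forall t x t' x',
  Rabs (f t' x' - f t x) <= K * (Rabs (t' - t) + Rabs (x' - x)).

Lemma lip2_continuous K f (X : R -> R) L : 0 <= K -> lip2 K f ->
  (forall r s, Rabs (X s - X r) <= L * Rabs (s - r)) ->
  forall r, continuous (fun r => f r (X r)) r.
Proof.
intros K0 Hf HX; apply (lipschitz_continuous _ (K * (1 + L))); intros r s.
eapply Rle_trans; [apply Hf|]; rewrite Rmult_assoc.
apply Rmult_le_compat_l; [exact K0|]; generalize (HX r s); lra.
Qed.

Fixpoint picard (f : R -> R -> R) (t x : R) (n : nat) : R -> R :=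
  match n with
  | O => fun _ => x
  | S n => fun s => x + RInt (fun r => f r (picard f t x n r)) t s
  end.

Section Flow.
Variables (K : R) (f : R -> R -> R).
Hypotheses (K0 : 0 < K) (Hfb : forall t x, Rabs (f t x) <= K) (Hf : lip2 K f).

(** This makes the integrands continuous, hence integrable. The constant does not depend on [n], so
    the bound survives in the limit. *)
Lemma picard_lipschitz t x n r s :
  Rabs (picard f t x n s - picard f t x n r) <= K * Rabs (s - r).
Proof.
revert r s; induction n as [|n IH]; intros r s; simpl.
- rewrite Rminus_diag, Rabs_R0; apply Rmult_le_pos; [lra|apply Rabs_pos].
- assert (Hc := lip2_continuous K f _ K (Rlt_le _ _ K0) Hf IH).
  rewrite plus_minus_cancel, RInt_increment by exact Hc; apply RInt_bound; auto.
Qed.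

Lemma picard_continuous t x n r : continuous (fun r => f r (picard f t x n r)) r.
Proof.
apply (lip2_continuous K f _ K (Rlt_le _ _ K0) Hf); intros; apply picard_lipschitz.
Qed.

(** With this weight the ratio 1/2 holds at any distance from [t]: the flow is built on the whole
    line at once, with no continuation from short times. *)
Lemma picard_step t x n s : Rabs (picard f t x (S n) s - picard f t x n s)
  <= (/ 2) ^ n * exp (2 * K * Rabs (s - t)).
Proof.
revert s; induction n as [|n IH]; intros s.
- simpl; rewrite Rplus_minus_l.
  rewrite Rmult_1_l; eapply Rle_trans.
  + apply RInt_bound; [|intros; apply Hfb].
    apply (lip2_continuous K f (fun _ => x) 0 (Rlt_le _ _ K0) Hf).
    intros; rewrite Rminus_diag, Rabs_R0; lra.
  + generalize (exp_ineq1_le (2 * K * Rabs (s - t))) (Rabs_pos (s - t)); nra.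
- change (picard f t x (S (S n)) s) with (x + RInt (fun r => f r (picard f t x (S n) r)) t s).
  change (picard f t x (S n) s) with (x + RInt (fun r => f r (picard f t x n r)) t s) at 1.
  rewrite plus_minus_cancel, RInt_difference by (intros; apply picard_continuous).
  eapply Rle_trans.
  + apply (RInt_exp_bound _ t s (K * (/ 2) ^ n) (2 * K)); [lra| | |].
    * apply Rmult_le_pos; [lra|apply pow_le; lra].
    * intros r; apply (continuous_minus (V := R_NormedModule)); apply picard_continuous.
    * intros r; eapply Rle_trans; [apply Hf|].
      rewrite Rminus_diag, Rabs_R0, Rplus_0_l, Rmult_assoc.
      apply Rmult_le_compat_l; [lra|apply IH].
  + right; simpl; field; lra.
Qed.

Lemma picard_cauchy t x n m s : Rabs (picard f t x (n + m) s - picard f t x n s)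
  <= 2 * (/ 2) ^ n * exp (2 * K * Rabs (s - t)).
Proof.
(* The exact partial sum of the geometric series, so that the induction on [m] closes. *)
enough (Rabs (picard f t x (n + m) s - picard f t x n s)
  <= 2 * ((/ 2) ^ n - (/ 2) ^ (n + m)) * exp (2 * K * Rabs (s - t))) as H.
{ eapply Rle_trans; [exact H|]; apply Rmult_le_compat_r; [left; apply exp_pos|].
  assert (0 < (/ 2) ^ (n + m)) by (apply pow_lt; lra); lra. }
induction m as [|m IH].
- rewrite Nat.add_0_r, !Rminus_diag, Rabs_R0; lra.
- rewrite Nat.add_succ_r.
  replace (picard f t x (S (n + m)) s - picard f t x n s) with
    ((picard f t x (S (n + m)) s - picard f t x (n + m) s) +
     (picard f t x (n + m) s - picard f t x n s)) by ring.
  eapply Rle_trans; [apply Rabs_triang|].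
  eapply Rle_trans; [apply Rplus_le_compat; [apply picard_step|exact IH]|].
  right; simpl pow; field.
Qed.

(** The trajectory that is at [x] at time [t], observed at time [s], which may precede [t]; the
    first integral will be its value at [s = 0]. *)
Definition flow (t x s : R) : R := real (Lim_seq (fun n => picard f t x n s)).

Lemma half_pow_small eps : 0 < eps -> exists n, (/ 2) ^ n < eps.
Proof.
intros He; destruct (pow_lt_1_zero (/ 2) ltac:(rewrite Rabs_right; lra) eps He) as [n Hn].
exists n; generalize (Hn n (Nat.le_refl n)); rewrite Rabs_right; [auto|].
apply Rle_ge, pow_le; lra.
Qed.

Lemma half_pow_zero z c : 0 <= c -> (forall n, Rabs z <= c * (/ 2) ^ n) -> z = 0.
Proof.
intros Hc H; destruct (Req_dec z 0) as [|Hz]; [assumption|exfalso].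
assert (Hp := Rabs_pos_lt _ Hz).
destruct (half_pow_small (Rabs z / (c + 1)) ltac:(apply Rdiv_lt_0_compat; lra)) as [n Hn].
assert (E : (c + 1) * (/ 2) ^ n < Rabs z).
{ apply (Rmult_lt_compat_l (c + 1)) in Hn; [|lra].
  replace ((c + 1) * (Rabs z / (c + 1))) with (Rabs z) in Hn by (field; lra); exact Hn. }
generalize (H n) (pow_le (/ 2) n ltac:(lra)); lra.
Qed.

Lemma flow_limit t x s : is_lim_seq (fun n => picard f t x n s) (flow t x s).
Proof.
apply Lim_seq_correct', ex_lim_seq_cauchy_corr; intros eps.
set (E := exp (2 * K * Rabs (s - t))); assert (HE : 0 < E) by apply exp_pos.
destruct (half_pow_small (eps / (4 * E))) as [N HN].
{ apply Rdiv_lt_0_compat; [apply cond_pos|lra]. }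
assert (HNE : 4 * (/ 2) ^ N * E < eps).
{ apply (Rmult_lt_compat_l (4 * E)) in HN; [|lra].
  replace (4 * E * (eps / (4 * E))) with (pos eps) in HN by (field; lra); lra. }
exists N; intros n m Hn Hm.
replace n with (N + (n - N))%nat by lia; replace m with (N + (m - N))%nat by lia.
generalize (picard_cauchy t x N (n - N) s) (picard_cauchy t x N (m - N) s); fold E.
generalize (picard f t x (N + (n - N)) s) (picard f t x (N + (m - N)) s) (picard f t x N s).
intros p q z H1 H2; replace (p - q) with ((p - z) + - (q - z)) by ring.
eapply Rle_lt_trans; [apply Rabs_triang|]; rewrite Rabs_Ropp; lra.
Qed.

Lemma flow_picard t x n s :
  Rabs (flow t x s - picard f t x n s) <= 2 * (/ 2) ^ n * exp (2 * K * Rabs (s - t)).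
Proof.
assert (H : Rbar_le (Rabs (flow t x s - picard f t x n s)) (2 * (/ 2) ^ n * exp (2 * K * Rabs (s - t)))).
{ apply (is_lim_seq_le (fun m => Rabs (picard f t x (n + m) s - picard f t x n s))
    (fun _ => 2 * (/ 2) ^ n * exp (2 * K * Rabs (s - t)))).
  - intros m; apply picard_cauchy.
  - apply (is_lim_seq_abs _ (Finite (flow t x s - picard f t x n s))).
    apply is_lim_seq_minus'; [|apply is_lim_seq_const].
    apply (is_lim_seq_ext (fun m => picard f t x (m + n) s)).
    + intros m; now rewrite Nat.add_comm.
    + now apply (is_lim_seq_incr_n (fun m => picard f t x m s) n), flow_limit.
  - apply is_lim_seq_const. }
exact H.
Qed.

Lemma flow_lipschitz t x r s : Rabs (flow t x s - flow t x r) <= K * Rabs (s - r).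
Proof.
assert (H : Rbar_le (Rabs (flow t x s - flow t x r)) (K * Rabs (s - r))).
{ apply (is_lim_seq_le (fun n => Rabs (picard f t x n s - picard f t x n r))
    (fun _ => K * Rabs (s - r))).
  - intros n; apply picard_lipschitz.
  - apply (is_lim_seq_abs _ (Finite (flow t x s - flow t x r))).
    apply is_lim_seq_minus'; apply flow_limit.
  - apply is_lim_seq_const. }
exact H.
Qed.

Lemma flow_continuous t x r : continuous (fun r => f r (flow t x r)) r.
Proof.
apply (lip2_continuous K f _ K (Rlt_le _ _ K0) Hf); intros; apply flow_lipschitz.
Qed.

(** Limit and integral are not interchanged: for every [n] both sides are within a multiple of
    [(/ 2) ^ n] of the same Picard iterate. *)
Lemma flow_integral t x s : flow t x s = x + RInt (fun r => f r (flow t x r)) t s.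
Proof.
apply Rminus_diag_uniq, half_pow_zero with (c := 2 * exp (2 * K * Rabs (s - t))).
{ generalize (exp_pos (2 * K * Rabs (s - t))); lra. }
intros n; set (E := exp (2 * K * Rabs (s - t))).
replace (flow t x s - (x + RInt (fun r => f r (flow t x r)) t s)) with
  ((flow t x s - picard f t x (S n) s) +
   (RInt (fun r => f r (picard f t x n r)) t s - RInt (fun r => f r (flow t x r)) t s))
  by (simpl picard; generalize (RInt (fun r => f r (picard f t x n r)) t s); intros; ring).
rewrite RInt_difference by (intros; first [apply picard_continuous | apply flow_continuous]).
eapply Rle_trans; [apply Rabs_triang|].
eapply Rle_trans.
{ apply Rplus_le_compat; [apply flow_picard|].
  apply (RInt_exp_bound _ t s (K * (2 * (/ 2) ^ n)) (2 * K)); [lra| | |].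
  - apply Rmult_le_pos; [lra|]; generalize (pow_le (/ 2) n ltac:(lra)); lra.
  - intros r; apply (continuous_minus (V := R_NormedModule));
      first [apply picard_continuous | apply flow_continuous].
  - intros r; eapply Rle_trans; [apply Hf|].
    rewrite Rminus_diag, Rabs_R0, Rplus_0_l, Rmult_assoc.
    apply Rmult_le_compat_l; [lra|]; rewrite Rabs_minus_sym; apply flow_picard. }
fold E; right; simpl; field; lra.
Qed.

Lemma flow_start t x : flow t x t = x.
Proof.
rewrite flow_integral, (RInt_point (V := R_CompleteNormedModule)); apply Rplus_0_r.
Qed.

Lemma flow_derive t x s : is_derive (flow t x) s (f s (flow t x s)).
Proof.
apply (is_derive_ext (fun s => plus x (RInt (fun r => f r (flow t x r)) t s))).
- intros r; symmetry; apply flow_integral.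
- rewrite <- (plus_zero_l (f s (flow t x s))).
  apply (is_derive_plus (V := R_NormedModule)); [apply (is_derive_const (V := R_NormedModule))|].
  apply (is_derive_RInt (V := R_NormedModule) (fun r => f r (flow t x r)) _ t); [|apply flow_continuous].
  apply filter_forall; intros r; apply (RInt_correct (V := R_CompleteNormedModule)).
  apply ex_RInt_continuous_all; intros; apply flow_continuous.
Qed.

End Flow.

(** * Second-order expansion of the flow *)

(** Gronwall in both directions of time. The sign [e] is the direction from [s] to [t], and the
    weighted square [F] does not decrease in that direction; squaring avoids differentiating an
    absolute value. *)
Lemma trajectory_gronwall K f X Y : lip2 K f ->
  (forall s, is_derive X s (f s (X s))) -> (forall s, is_derive Y s (f s (Y s))) ->
  forall s t, Rabs (X s - Y s) <= Rabs (X t - Y t) * exp (K * Rabs (s - t)).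
Proof.
intros Hf HX HY s t.
assert (He : exists e, Rabs (s - t) = e * (t - s) /\ (e = 1 \/ e = -1)).
{ unfold Rabs; destruct Rcase_abs; [exists 1|exists (-1)]; split; auto; ring. }
destruct He as [e [Ee He]].
set (F := fun r => (X r - Y r) ^ 2 * exp (e * (2 * K * r))).
set (dF := fun r => (2 * (X r - Y r) * (f r (X r) - f r (Y r)) + e * (2 * K * (X r - Y r) ^ 2))
  * exp (e * (2 * K * r))).
assert (HF : forall r, is_derive F r (dF r)).
{ intros r; unfold F, dF; auto_derive.
  - repeat split; eexists; [apply HX|apply HY].
  - rewrite (is_derive_unique (fun x : R => X x) r _ (HX r)), (is_derive_unique (fun x : R => Y x) r _ (HY r)).
    unfold Rminus; ring. }
assert (HD : forall r, 0 <= e * dF r).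
{ intros r; unfold dF.
  assert (Hfr := Hf r (Y r) r (X r)); rewrite Rminus_diag, Rabs_R0, Rplus_0_l in Hfr.
  assert (Hm : Rabs ((X r - Y r) * (f r (X r) - f r (Y r))) <= K * (X r - Y r) ^ 2).
  { rewrite Rabs_mult, <- pow2_abs; generalize (Rabs_pos (X r - Y r)); nra. }
  apply Rabs_le_between in Hm.
  rewrite <- Rmult_assoc; apply Rmult_le_pos; [|left; apply exp_pos].
  destruct He as [-> | ->]; lra. }
assert (Hst : F s <= F t).
{ destruct (MVT_gen F s t dF) as [c [Hc E]].
  - intros x _; apply HF.
  - intros x _; apply derivable_continuous_pt; exists (dF x); apply is_derive_Reals, HF.
  - assert (0 <= e * (t - s)) by (rewrite <- Ee; apply Rabs_pos).
    assert (e * e = 1) by (destruct He as [-> | ->]; ring).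
    assert (dF c * (t - s) = (e * dF c) * (e * (t - s)))
      by (transitivity (e * e * (dF c * (t - s))); [rewrite H0|]; ring).
    generalize (Rmult_le_pos _ _ (HD c) H); lra. }
apply Rsqr_incr_0_var; [|apply Rmult_le_pos; [apply Rabs_pos|left; apply exp_pos]].
unfold Rsqr.
replace (Rabs (X s - Y s) * Rabs (X s - Y s)) with ((X s - Y s) ^ 2)
  by (rewrite <- pow2_abs; ring).
replace (Rabs (X t - Y t) * exp (K * Rabs (s - t)) * (Rabs (X t - Y t) * exp (K * Rabs (s - t))))
  with ((X t - Y t) ^ 2 * exp (e * (2 * K * t) - e * (2 * K * s))).
2:{ rewrite <- (pow2_abs (X t - Y t)), Ee.
    replace (e * (2 * K * t) - e * (2 * K * s)) with (K * (e * (t - s)) + K * (e * (t - s))) by ring.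
    rewrite exp_plus; ring. }
unfold F in Hst.
replace (exp (e * (2 * K * t) - e * (2 * K * s))) with
  (exp (e * (2 * K * t)) * / exp (e * (2 * K * s))) by (unfold Rminus; now rewrite exp_plus, exp_Ropp).
rewrite <- Rmult_assoc.
apply (Rmult_le_reg_r (exp (e * (2 * K * s)))); [apply exp_pos|].
rewrite (Rmult_assoc _ (/ _)), Rinv_l, Rmult_1_r; [exact Hst|].
generalize (exp_pos (e * (2 * K * s))); lra.
Qed.

(** Both sides are trajectories in [r] that agree at [r = s], so Gronwall makes them equal. *)
Lemma flow_flow K f t x s r : 0 < K -> (forall t x, Rabs (f t x) <= K) -> lip2 K f ->
  flow f s (flow f t x s) r = flow f t x r.
Proof.
intros K0 Hb Hf; apply Rminus_diag_uniq.
assert (H := trajectory_gronwall K f (flow f s (flow f t x s)) (flow f t x) Hf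
  (flow_derive K f K0 Hb Hf s _) (flow_derive K f K0 Hb Hf t x) r s).
rewrite (flow_start K f K0 Hb Hf), Rminus_diag, Rabs_R0, Rmult_0_l in H.
destruct (Req_dec (flow f s (flow f t x s) r - flow f t x r) 0) as [|Hne]; [assumption|].
apply Rabs_pos_lt in Hne; lra.
Qed.

Lemma exp_le_compat x y : x <= y -> exp x <= exp y.
Proof. intros [H|H]; [left; now apply exp_increasing|right; now f_equal]. Qed.

(** The derivative of [flow f t x 0] in [x] when [g] is the derivative of [f] in [x]: the linearised
    equation along the trajectory, solved backwards from [t] to 0, hence the minus sign. Being an
    exponential, it is positive. *)
Definition flow_dx (f g : R -> R -> R) (t x : R) : R :=
  exp (- RInt (fun r => g r (flow f t x r)) 0 t).

Lemma flow_dx_bounds K f g t x T : 0 < K -> (forall t x, Rabs (f t x) <= K) -> lip2 K f ->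
  (forall t x, Rabs (g t x) <= K) -> lip2 K g -> 0 <= t <= T ->
  exp (- (K * T)) <= flow_dx f g t x <= exp (K * T).
Proof.
intros K0 Hb Hf Hgb Hg Ht; unfold flow_dx.
assert (H : Rabs (RInt (fun r => g r (flow f t x r)) 0 t) <= K * T).
{ eapply Rle_trans; [apply RInt_bound|].
  - apply (lip2_continuous K g _ K (Rlt_le _ _ K0) Hg); apply flow_lipschitz; assumption.
  - auto.
  - rewrite Rminus_0_r, Rabs_right by lra; nra. }
apply Rabs_le_between in H.
split; apply exp_le_compat; lra.
Qed.

(* The difference D of two trajectories solves D' = g D + O(D^2); variation of
   constants turns this into a second-order expansion of the flow in x. *)
Lemma flow_taylor_space K f g T : 0 < K -> (forall t x, Rabs (f t x) <= K) -> lip2 K f ->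
  (forall t x, Rabs (g t x) <= K) -> lip2 K g ->
  (forall t, taylor (fun _ => True) (f t) (g t) K) ->
  forall t, 0 <= t <= T ->
  taylor (fun _ => True) (fun x => flow f t x 0) (flow_dx f g t) (K * exp (3 * (K * T)) * T).
Proof.
intros K0 Hb Hf Hgb Hg HT t Ht x y _ _.
set (D := fun r => flow f t y r - flow f t x r).
set (G := fun r => g r (flow f t x r)).
assert (HG : forall r, continuous G r).
{ apply (lip2_continuous K g _ K (Rlt_le _ _ K0) Hg); apply flow_lipschitz; assumption. }
set (I0 := fun r => RInt G 0 r).
assert (HI : forall r, is_derive I0 r (G r)).
{ intros r; apply (is_derive_RInt (V := R_NormedModule) G _ 0); [|apply HG].
  apply filter_forall; intros s; apply (RInt_correct (V := R_CompleteNormedModule)).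
  now apply ex_RInt_continuous_all. }
assert (HIb : forall r, Rabs (I0 r) <= K * Rabs r).
{ intros r; unfold I0; rewrite <- (Rminus_0_r r) at 2; apply RInt_bound; [exact HG|].
  intros; apply Hgb. }
set (H := fun r => D r * exp (- I0 r)).
set (dH := fun r => (f r (flow f t y r) - f r (flow f t x r) - G r * D r) * exp (- I0 r)).
assert (HH : forall r, is_derive H r (dH r)).
{ intros r; unfold H, dH, D; auto_derive.
  - repeat split; [exists (f r (flow f t y r))|exists (f r (flow f t x r))|eexists; apply HI];
      now apply (flow_derive K).
  - rewrite (is_derive_unique (fun x0 : R => flow f t y x0) r _ (flow_derive K f K0 Hb Hf t y r)),
      (is_derive_unique (fun x0 : R => flow f t x x0) r _ (flow_derive K f K0 Hb Hf t x r)),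
      (is_derive_unique (fun x : R => I0 x) r _ (HI r)).
    unfold Rminus; ring. }
(* Two factors [exp (K * T)] come from the square of the Gronwall bound on [D], the third from the
   integrating factor. *)
assert (HdH : forall r, 0 <= r <= t -> Rabs (dH r) <= K * exp (3 * (K * T)) * (y - x) ^ 2).
{ intros r Hr; unfold dH; rewrite Rabs_mult.
  assert (H1 := HT r (flow f t x r) (flow f t y r) I I); fold (G r) (D r) in H1.
  assert (H2 := trajectory_gronwall K f _ _ Hf (flow_derive K f K0 Hb Hf t y)
    (flow_derive K f K0 Hb Hf t x) r t).
  fold (D r) in H2; rewrite !(flow_start K f K0 Hb Hf) in H2.
  assert (H3 : exp (K * Rabs (r - t)) <= exp (K * T)).
  { apply exp_le_compat; apply Rmult_le_compat_l; [lra|]; unfold Rabs; destruct Rcase_abs; lra. }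
  assert (H4 : exp (- I0 r) <= exp (K * T)).
  { apply exp_le_compat; generalize (HIb r); rewrite (Rabs_right r) by lra; intros H4.
    apply Rabs_le_between in H4; nra. }
  rewrite (Rabs_right (exp _)) by (left; apply exp_pos).
  assert (H5 : D r ^ 2 <= (Rabs (y - x) * exp (K * T)) ^ 2).
  { rewrite <- pow2_abs; apply pow_incr; split; [apply Rabs_pos|].
    eapply Rle_trans; [exact H2|]; apply Rmult_le_compat_l; [apply Rabs_pos|exact H3]. }
  rewrite Rpow_mult_distr, pow2_abs in H5.
  replace (exp (3 * (K * T))) with (exp (K * T) ^ 2 * exp (K * T)).
  2:{ replace (3 * (K * T)) with (K * T + K * T + K * T) by ring; rewrite !exp_plus; ring. }
  replace (K * (exp (K * T) ^ 2 * exp (K * T)) * (y - x) ^ 2) with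
    (K * ((y - x) ^ 2 * exp (K * T) ^ 2) * exp (K * T)) by ring.
  apply Rmult_le_compat; [apply Rabs_pos|left; apply exp_pos| |exact H4].
  eapply Rle_trans; [exact H1|]; apply Rmult_le_compat_l; lra. }
assert (Hinc : Rabs (H 0 - H t) <= K * exp (3 * (K * T)) * (y - x) ^ 2 * Rabs (0 - t)).
{ apply (is_derive_increment_bound H dH); [auto|].
  rewrite Rmin_right, Rmax_left by lra; exact HdH. }
assert (H0 : H 0 = flow f t y 0 - flow f t x 0).
{ unfold H, I0; rewrite (RInt_point (V := R_CompleteNormedModule)); unfold zero; simpl.
  rewrite Ropp_0, exp_0; unfold D; ring. }
assert (Ht' : H t = flow_dx f g t x * (y - x)).
{ unfold H, D; rewrite !(flow_start K f K0 Hb Hf); unfold flow_dx, I0, G; ring. }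
rewrite H0, Ht' in Hinc; eapply Rle_trans; [exact Hinc|].
replace (Rabs (0 - t)) with t by (rewrite Rabs_left1; lra).
replace (K * exp (3 * (K * T)) * T * (y - x) ^ 2) with (K * exp (3 * (K * T)) * (y - x) ^ 2 * T) by ring.
apply Rmult_le_compat_l; [|lra].
apply Rmult_le_pos; [|apply pow2_ge_0]; apply Rmult_le_pos; [lra|left; apply exp_pos].
Qed.

Lemma mixed_square_bound p q : Rabs p * Rabs q <= p ^ 2 + q ^ 2.
Proof.
rewrite <- (pow2_abs p), <- (pow2_abs q).
generalize (Rabs_pos p) (Rabs_pos q) (pow2_ge_0 (Rabs p - Rabs q)); nra.
Qed.

(** The group property turns the increment in time into one in space: the trajectory through
    [(t', x')] is at [y] at time [t], so the spatial expansion applies to [x] and [y], and [y] is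
    [x' - (t' - t) * f t x] up to second order. This is where the time derivative [- f] times the
    space derivative comes from. *)
Lemma flow_taylor K f g T : 0 < K -> (forall t x, Rabs (f t x) <= K) -> lip2 K f ->
  (forall t x, Rabs (g t x) <= K) -> lip2 K g ->
  (forall t, taylor (fun _ => True) (f t) (g t) K) -> 0 < T ->
  exists C, 0 <= C /\ forall t x t' x', 0 <= t <= T -> 0 <= t' <= T ->
    Rabs (flow f t' x' 0 - flow f t x 0
          - flow_dx f g t x * (x' - x - (t' - t) * f t x))
      <= C * ((t' - t) ^ 2 + (x' - x) ^ 2).
Proof.
intros K0 Hb Hf Hgb Hg HT T0.
set (C1 := K * exp (3 * (K * T)) * T).
assert (C10 : 0 <= C1).
{ apply Rmult_le_pos; [apply Rmult_le_pos; [lra|left; apply exp_pos]|lra]. }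
(* [A] bounds the error made in replacing [y] by [x' - (t' - t) * f t x]; the factor
   [2 * (K ^ 2 + 1)] below compares [(y - x) ^ 2] with the squared increments. *)
set (A := K * (2 + K)).
assert (A0 : 0 <= A) by (unfold A; nra).
assert (Q0 := exp_pos (K * T)).
exists (C1 * (2 * (K ^ 2 + 1)) + exp (K * T) * A); split.
{ apply Rplus_le_le_0_compat; apply Rmult_le_pos; try lra; nra. }
intros t x t' x' Ht Ht'.
set (y := flow f t' x' t).
assert (Hyx' : Rabs (y - x') <= K * Rabs (t' - t)).
{ unfold y; rewrite <- (flow_start K f K0 Hb Hf t' x') at 2.
  rewrite (Rabs_minus_sym t' t); apply flow_lipschitz; assumption. }
assert (Hy : Rabs (y - (x' - (t' - t) * f t x)) <= A * ((t' - t) ^ 2 + (x' - x) ^ 2)).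
(* Once the uniform motion is subtracted, the speed is of first order in the increments, over a time
   [t' - t]. *)
{ set (k := fun r => flow f t' x' r - r * f t x).
  assert (Hk : Rabs (k t - k t') <= K * ((1 + K) * Rabs (t' - t) + Rabs (x' - x)) * Rabs (t - t')).
  { apply (is_derive_increment_bound k (fun r => f r (flow f t' x' r) - f t x)).
    - intros r _; unfold k; auto_derive; [exists (f r (flow f t' x' r)); exact (flow_derive K f K0 Hb Hf t' x' r)|].
      rewrite (is_derive_unique (fun x : R => flow f t' x' x) r _ (flow_derive K f K0 Hb Hf t' x' r)); ring.
    - intros r Hr; eapply Rle_trans; [apply Hf|]; apply Rmult_le_compat_l; [lra|].
      assert (Hr1 : Rabs (r - t) <= Rabs (t' - t) /\ Rabs (r - t') <= Rabs (t' - t)).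
      { revert Hr; unfold Rmin, Rmax; destruct Rle_dec; unfold Rabs; repeat destruct Rcase_abs; lra. }
      assert (Hr2 : Rabs (flow f t' x' r - x') <= K * Rabs (r - t')).
      { rewrite <- (flow_start K f K0 Hb Hf t' x') at 2; apply flow_lipschitz; assumption. }
      replace (flow f t' x' r - x) with ((flow f t' x' r - x') + (x' - x)) by ring.
      generalize (Rabs_triang (flow f t' x' r - x') (x' - x)); nra. }
  replace (k t - k t') with (y - (x' - (t' - t) * f t x)) in Hk.
  2:{ unfold k, y; rewrite (flow_start K f K0 Hb Hf); ring. }
  eapply Rle_trans; [exact Hk|].
  rewrite (Rabs_minus_sym t t'); generalize (mixed_square_bound (t' - t) (x' - x)).
  rewrite <- (pow2_abs (t' - t)), <- (pow2_abs (x' - x)); unfold A.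
  generalize (Rabs_pos (t' - t)) (Rabs_pos (x' - x)).
  generalize (Rabs (t' - t)) (Rabs (x' - x)); intros p q Hp Hq Hpq.
  replace (K * ((1 + K) * p + q) * p) with (K * ((1 + K) * p ^ 2 + p * q)) by ring.
  rewrite Rmult_assoc; apply Rmult_le_compat_l; [lra|].
  generalize (pow2_ge_0 p) (pow2_ge_0 q); nra. }
assert (Hyx : (y - x) ^ 2 <= 2 * (K ^ 2 + 1) * ((t' - t) ^ 2 + (x' - x) ^ 2)).
{ replace (y - x) with ((y - x') + (x' - x)) by ring.
  assert ((y - x') ^ 2 <= K ^ 2 * (t' - t) ^ 2).
  { rewrite <- (pow2_abs (y - x')), <- (pow2_abs (t' - t)), <- Rpow_mult_distr.
    apply pow_incr; split; [apply Rabs_pos|exact Hyx']. }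
  generalize (pow2_ge_0 (y - x' - (x' - x))) (pow2_ge_0 (t' - t)) (pow2_ge_0 (x' - x)) (pow2_ge_0 K); nra. }
rewrite <- (flow_flow K f t' x' t 0 K0 Hb Hf); fold y.
replace (flow f t y 0 - flow f t x 0 - flow_dx f g t x * (x' - x - (t' - t) * f t x)) with
  ((flow f t y 0 - flow f t x 0 - flow_dx f g t x * (y - x)) +
   flow_dx f g t x * (y - (x' - (t' - t) * f t x))) by ring.
eapply Rle_trans; [apply Rabs_triang|]; rewrite Rabs_mult.
destruct (flow_dx_bounds K f g t x T K0 Hb Hf Hgb Hg Ht) as [Q1 Q2].
assert (Q3 := exp_pos (- (K * T))).
rewrite (Rabs_right (flow_dx f g t x)) by lra.
assert (E1 := flow_taylor_space K f g T K0 Hb Hf Hgb Hg HT t Ht x y I I); fold C1 in E1.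
rewrite Rmult_plus_distr_r; apply Rplus_le_compat.
- eapply Rle_trans; [exact E1|]; rewrite Rmult_assoc; now apply Rmult_le_compat_l.
- rewrite Rmult_assoc; apply Rmult_le_compat; try lra; apply Rabs_pos.
Qed.

(** * The first integral *)

Lemma grad_slice_x D f t x lt lx (S : R -> Prop) : S x -> (forall y, S y -> D (t, y)) ->
  is_grad_within D f (t, x) lt lx -> is_derive_within S (fun y => f (t, y)) x lx.
Proof.
intros Sx SD H; rewrite is_grad_within_iff in H by auto.
apply is_derive_within_iff; [exact Sx|]; intros eps Heps.
destruct (H eps Heps) as [d [Hd0 Hd]]; exists d; split; [exact Hd0|]; intros y Sy Hy.
generalize (Hd t y (SD y Sy)); rewrite !Rminus_diag, Rabs_R0, Rmult_0_l, !Rplus_0_l.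
rewrite (Rmult_comm lx); auto.
Qed.

Lemma grad_slice_t D f t x lt lx (S : R -> Prop) : S t -> (forall s, S s -> D (s, x)) ->
  is_grad_within D f (t, x) lt lx -> is_derive_within S (fun s => f (s, x)) t lt.
Proof.
intros Sx SD H; rewrite is_grad_within_iff in H by auto.
apply is_derive_within_iff; [exact Sx|]; intros eps Heps.
destruct (H eps Heps) as [d [Hd0 Hd]]; exists d; split; [exact Hd0|]; intros y Sy Hy.
generalize (Hd y x (SD y Sy)); rewrite !Rminus_diag, Rabs_R0, Rmult_0_l, !Rplus_0_r.
rewrite (Rmult_comm lt); auto.
Qed.

Lemma rect_half_strip T p : rect T p -> half_strip p.
Proof. unfold rect, half_strip; tauto. Qed.

Definition rect_lipschitz (T K : R) (f : R * R -> R) : Prop :=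
  forall t x t' x', rect T (t, x) -> rect T (t', x') ->
  Rabs (f (t', x') - f (t, x)) <= K * (Rabs (t' - t) + Rabs (x' - x)).

Definition rect_bounded (T K : R) (f : R * R -> R) : Prop :=
  forall t x, rect T (t, x) -> Rabs (f (t, x)) <= K.

Lemma rect_lipschitz_bounded T L f : 0 < T -> 0 <= L -> rect_lipschitz T L f ->
  rect_bounded T (Rabs (f (0, 0)) + L * (T + 1)) f.
Proof.
intros T0 L0 H t x [Ht Hx]; simpl in *.
replace (f (t, x)) with (f (0, 0) + (f (t, x) - f (0, 0))) by ring.
eapply Rle_trans; [apply Rabs_triang|]; apply Rplus_le_compat_l.
eapply Rle_trans; [apply (H 0 0 t x); split; simpl; lra|].
apply Rmult_le_compat_l; [lra|]; rewrite !Rminus_0_r, !Rabs_right; lra.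
Qed.

Lemma C1_rect_estimates v vt vx T : C1_with v vt vx -> 0 < T ->
  lipschitz_on (rect T) vt -> lipschitz_on (rect T) vx ->
  exists K, 0 < K /\ rect_bounded T K v /\ rect_lipschitz T K v /\
    rect_bounded T K vx /\ rect_lipschitz T K vx /\
    forall t, 0 <= t <= T -> taylor (seg 0 1) (fun x => v (t, x)) (fun x => vx (t, x)) K.
Proof.
intros [Hgrad _] T0 Hvt Hvx.
apply lipschitz_on_pair_iff in Hvt; apply lipschitz_on_pair_iff in Hvx.
destruct Hvt as [L1 [L10 Hvt]]; destruct Hvx as [L2 [L20 Hvx]].
assert (Bt := rect_lipschitz_bounded T L1 vt T0 L10 Hvt).
assert (Bx := rect_lipschitz_bounded T L2 vx T0 L20 Hvx).
set (B1 := Rabs (vt (0, 0)) + L1 * (T + 1)) in *.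
set (B2 := Rabs (vx (0, 0)) + L2 * (T + 1)) in *.
assert (B10 : 0 <= B1) by (unfold B1; generalize (Rabs_pos (vt (0, 0))); nra).
assert (B20 : 0 <= B2) by (unfold B2; generalize (Rabs_pos (vx (0, 0))); nra).
assert (Hx : forall t, 0 <= t <= T -> forall x, seg 0 1 x ->
  is_derive_within (seg 0 1) (fun x => v (t, x)) x (vx (t, x))).
{ intros t Ht x Hx; apply (grad_slice_x half_strip v t x (vt (t, x)) (vx (t, x))); [exact Hx| |].
  - intros y Hy; split; simpl; [lra|exact Hy].
  - apply Hgrad; split; simpl; [lra|exact Hx]. }
assert (Ht : forall x, 0 <= x <= 1 -> forall t, seg 0 T t ->
  is_derive_within (seg 0 T) (fun t => v (t, x)) t (vt (t, x))).
{ intros x Hx' t Ht; unfold seg in Ht.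
  apply (grad_slice_t half_strip v t x (vt (t, x)) (vx (t, x))); [exact Ht| |].
  - intros y Hy; unfold seg in Hy; split; simpl; lra.
  - apply Hgrad; split; simpl; lra. }
assert (Lv : rect_lipschitz T (B1 + B2) v).
{ intros t x t' x' [P1 P2] [P3 P4]; simpl in *.
  replace (v (t', x') - v (t, x)) with ((v (t', x') - v (t, x')) + (v (t, x') - v (t, x))) by ring.
  eapply Rle_trans; [apply Rabs_triang|].
  destruct (MVT_seg 0 T _ _ (Ht x' P4) t t' P1 P3) as [c [Hc Ec]].
  destruct (MVT_seg 0 1 _ _ (Hx t P1) x x' P2 P4) as [d [Hd Ed]].
  rewrite Ec, Ed, !Rabs_mult.
  assert (Rabs (vt (c, x')) <= B1).
  { apply Bt; split; simpl; [|exact P4]; revert Hc; unfold Rmin, Rmax; destruct Rle_dec; lra. }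
  assert (Rabs (vx (t, d)) <= B2).
  { apply Bx; split; simpl; [exact P1|]; revert Hd; unfold Rmin, Rmax; destruct Rle_dec; lra. }
  generalize (Rabs_pos (t' - t)) (Rabs_pos (x' - x)); nra. }
assert (Bv := rect_lipschitz_bounded T (B1 + B2) v T0 ltac:(lra) Lv).
set (B3 := Rabs (v (0, 0)) + (B1 + B2) * (T + 1)) in *.
assert (B30 : 0 <= B3) by (unfold B3; generalize (Rabs_pos (v (0, 0))); nra).
exists (1 + B1 + B2 + B3 + L2); split; [lra|].
repeat split.
- intros t x P; generalize (Bv t x P); lra.
- intros t x t' x' P P'; eapply Rle_trans; [apply (Lv t x t' x' P P')|].
  generalize (Rabs_pos (t' - t)) (Rabs_pos (x' - x)); nra.
- intros t x P; generalize (Bx t x P); lra.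
- intros t x t' x' P P'; eapply Rle_trans; [apply (Hvx t x t' x' P P')|].
  generalize (Rabs_pos (t' - t)) (Rabs_pos (x' - x)); nra.
- intros t P; apply (taylor_weaken _ _ _ L2); [lra|].
  apply taylor_of_derive; [now apply Hx|].
  intros x y Sx Sy; eapply Rle_trans; [apply (Hvx t x t y); split; assumption|].
  rewrite Rminus_diag, Rabs_R0; lra.
Qed.

(* Second-order expansion of [w], with spatial derivative [p] and time
   derivative [- v p] as dictated by the transport equation. *)
Definition transport_taylor (T : R) (v w p : R * R -> R) (C : R) : Prop :=
  forall t x t' x', rect T (t, x) -> rect T (t', x') ->
  Rabs (w (t', x') - w (t, x) - p (t, x) * (x' - x - (t' - t) * v (t, x)))
    <= C * ((t' - t) ^ 2 + (x' - x) ^ 2).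

Lemma product_increment_bound a b c d M : Rabs c <= 1 -> Rabs b <= M ->
  Rabs (a * c - b * d) <= Rabs (a - b) + M * Rabs (c - d).
Proof.
intros Hc Hb; replace (a * c - b * d) with ((a - b) * c + b * (c - d)) by ring.
eapply Rle_trans; [apply Rabs_triang|]; rewrite !Rabs_mult.
generalize (Rabs_pos (a - b)) (Rabs_pos (c - d)); nra.
Qed.

(** Freezing time outside [[0, T]] and extending in space turn the bounds on the rectangle into the
    global ones that the flow requires. The uniform [q0] is what later keeps the slope of [z (t, 0)]
    away from 0. *)
Lemma exists_first_integral v T : C1_loc_lipschitz v -> 0 < T ->
  exists z q C q0, 0 <= C /\ 0 < q0 /\
    (forall x, z (0, x) = x) /\ (forall x, q (0, x) = 1) /\
    (forall t x, rect T (t, x) -> q0 <= q (t, x) <= / q0) /\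
    transport_taylor T v z q C.
Proof.
intros [vt [vx [HC1 Hlip]]] T0.
destruct (Hlip T T0) as [Hvt Hvx].
destruct (C1_rect_estimates v vt vx T HC1 T0 Hvt Hvx) as [K [K0 [Bv [Lv [Bx [Lx Hv]]]]]].
set (ct := clamp 0 T).
assert (Hct : forall t, 0 <= ct t <= T) by (intros t; apply clamp_seg; lra).
set (f := fun t => ext 0 1 (fun x => v (ct t, x)) (fun x => vx (ct t, x))).
set (g := fun t => dext 0 1 (fun x => vx (ct t, x))).
assert (Hcr : forall t x, rect T (ct t, clamp 0 1 x)).
{ intros t x; split; simpl; [apply Hct|apply clamp_seg; lra]. }
assert (Hsin : forall z, Rabs (sin z) <= 1) by (intros z; apply Rabs_le; generalize (SIN_bound z); lra).
assert (Hcos : forall z, Rabs (cos z) <= 1) by (intros z; apply Rabs_le; generalize (COS_bound z); lra).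
assert (Hclip : forall t t', Rabs (ct t' - ct t) <= Rabs (t' - t)) by (intros; apply clamp_lipschitz).
(* The factor 9 is dictated by [ext_taylor]; the other bounds are relaxed to it, because the flow
   lemmas take a single constant. *)
assert (Hfb : forall t x, Rabs (f t x) <= 9 * K).
{ intros t x; unfold f, ext; eapply Rle_trans; [apply Rabs_triang|]; rewrite Rabs_mult.
  generalize (Bv _ _ (Hcr t x)) (Bx _ _ (Hcr t x)) (Hsin (x - clamp 0 1 x))
    (Rabs_pos (sin (x - clamp 0 1 x))) (Rabs_pos (vx (ct t, clamp 0 1 x))); nra. }
assert (Hgb : forall t x, Rabs (g t x) <= 9 * K).
{ intros t x; apply Rle_trans with K; [|lra]; apply dext_bound; [lra|].
  intros y Hy; apply Bx; split; simpl; [apply Hct|exact Hy]. }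
assert (Hf : lip2 (9 * K) f).
{ intros t x t' x'; unfold f, ext.
  generalize (Lv _ _ _ _ (Hcr t x) (Hcr t' x')) (Lx _ _ _ _ (Hcr t x) (Hcr t' x'))
    (product_increment_bound (vx (ct t', clamp 0 1 x')) (vx (ct t, clamp 0 1 x))
      (sin (x' - clamp 0 1 x')) (sin (x - clamp 0 1 x)) K (Hsin _) (Bx _ _ (Hcr t x)))
    (sin_lipschitz (x - clamp 0 1 x) (x' - clamp 0 1 x'))
    (clamp_rest_lipschitz 0 1 x x' Rle_0_1) (clamp_lipschitz 0 1 x x') (Hclip t t')
    (Rabs_triang (v (ct t', clamp 0 1 x') - v (ct t, clamp 0 1 x))
      (vx (ct t', clamp 0 1 x') * sin (x' - clamp 0 1 x') - vx (ct t, clamp 0 1 x) * sin (x - clamp 0 1 x)))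
    (Rabs_pos (t' - t)) (Rabs_pos (x' - x)).
  match goal with |- _ -> _ -> _ -> _ -> _ -> _ -> _ -> Rabs ?a <= _ -> _ -> _ -> Rabs ?b <= _ =>
    replace b with a by ring end.
  intros; nra. }
assert (Hg : lip2 (9 * K) g).
{ intros t x t' x'; unfold g, dext.
  generalize (Lx _ _ _ _ (Hcr t x) (Hcr t' x'))
    (product_increment_bound (vx (ct t', clamp 0 1 x')) (vx (ct t, clamp 0 1 x))
      (cos (x' - clamp 0 1 x')) (cos (x - clamp 0 1 x)) K (Hcos _) (Bx _ _ (Hcr t x)))
    (cos_lipschitz (x - clamp 0 1 x) (x' - clamp 0 1 x'))
    (clamp_rest_lipschitz 0 1 x x' Rle_0_1) (clamp_lipschitz 0 1 x x') (Hclip t t')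
    (Rabs_pos (t' - t)) (Rabs_pos (x' - x)).
  intros; nra. }
assert (HT : forall t, taylor (fun _ => True) (f t) (g t) (9 * K)).
{ intros t; apply ext_taylor; [lra|apply Hv, Hct|].
  intros x Hx; apply Bx; split; simpl; [apply Hct|exact Hx]. }
destruct (flow_taylor (9 * K) f g T ltac:(lra) Hfb Hf Hgb Hg HT T0) as [C [C0 HC]].
exists (fun p => flow f (fst p) (snd p) 0), (fun p => flow_dx f g (fst p) (snd p)), C, (exp (- (9 * K * T))).
repeat split.
- exact C0.
- apply exp_pos.
- intros x; simpl; apply (flow_start (9 * K)); auto; lra.
- intros x; simpl; unfold flow_dx.
  rewrite (RInt_point (V := R_CompleteNormedModule)); unfold zero; simpl.
  now rewrite Ropp_0, exp_0.
- apply (flow_dx_bounds (9 * K)); auto; [lra|apply H].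
- rewrite <- exp_Ropp, Ropp_involutive; apply (flow_dx_bounds (9 * K)); auto; [lra|apply H].
- intros t x t' x' [P1 P2] [P3 P4]; simpl in *.
  replace (v (t, x)) with (f t x); [now apply HC|].
  unfold f, ct; rewrite ext_id by exact P2; now rewrite clamp_id.
Qed.

(** * Expansions relative to the transport equation *)

Lemma transport_taylor_slice_x T v w p C t : 0 <= t <= T -> transport_taylor T v w p C ->
  taylor (seg 0 1) (fun x => w (t, x)) (fun x => p (t, x)) C.
Proof.
intros Ht H x y Sx Sy.
generalize (H t x t y (conj Ht Sx) (conj Ht Sy)).
rewrite Rminus_diag, Rmult_0_l, Rminus_0_r, pow_ne_zero, Rplus_0_l by lia; auto.
Qed.

Lemma transport_taylor_slice_t T v w p C x : 0 <= x <= 1 -> transport_taylor T v w p C ->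
  taylor (seg 0 T) (fun t => w (t, x)) (fun t => - (p (t, x) * v (t, x))) C.
Proof.
intros Hx H t s St Ss.
generalize (H t x s x (conj St Hx) (conj Ss Hx)).
rewrite Rminus_diag, (pow_ne_zero 2), Rplus_0_r by lia.
match goal with |- Rabs ?a <= _ -> Rabs ?b <= _ => replace b with a by ring end; auto.
Qed.

(* The Taylor expansions between P and Q, between P and R and between Q and R,
   where R is Q shifted in the x direction by a length comparable to |P - Q|,
   compare the x derivatives at P and Q. *)
Lemma transport_taylor_lipschitz T v w p C : 0 < T -> 0 <= C -> transport_taylor T v w p C ->
  rect_lipschitz T (12 * C * (T + 1)) p.
Proof.
intros T0 C0 H t x t' x' P Q.
set (d := Rabs (t' - t) + Rabs (x' - x)).
assert (Hb : 0 <= Rabs (t' - t) <= T /\ 0 <= Rabs (x' - x) <= 1).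
{ destruct P as [P1 P2], Q as [Q1 Q2]; simpl in *.
  unfold Rabs; repeat destruct Rcase_abs; lra. }
destruct (Req_dec d 0) as [Hd|Hd].
{ assert (E1 : Rabs (t' - t) = 0) by (unfold d in Hd; lra).
  assert (E2 : Rabs (x' - x) = 0) by (unfold d in Hd; lra).
  assert (t' - t = 0) by (destruct (Req_dec (t' - t) 0) as [|N]; [assumption|apply Rabs_no_R0 in N; lra]).
  assert (x' - x = 0) by (destruct (Req_dec (x' - x) 0) as [|N]; [assumption|apply Rabs_no_R0 in N; lra]).
  replace t' with t by lra; replace x' with x by lra.
  rewrite Rminus_diag, Rabs_R0, Hd; lra. }
(* As [d <= T + 1], this gives [dl <= / 2], so that one of [x' + dl] and [x' - dl] stays in
   [[0, 1]]. Dividing the bound [6 * C * d ^ 2] by [dl] produces the constant [12 * C * (T + 1)]. *)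
set (dl := d / (2 * (T + 1))).
assert (Ed : d = 2 * (T + 1) * dl) by (unfold dl; field; lra).
assert (Hdl : 0 < dl <= / 2).
{ assert (0 < d <= T + 1) by (unfold d in *; lra); split; nra. }
assert (Hsg : exists sg, (sg = 1 \/ sg = -1) /\ 0 <= x' + sg * dl <= 1).
{ destruct Q as [_ Q2]; simpl in Q2; destruct (Rle_dec x' (/ 2)); [exists 1|exists (-1)];
    split; auto; lra. }
destruct Hsg as [sg [Hsg Hx'']].
assert (R : rect T (t', x' + sg * dl)) by (split; [apply Q|exact Hx'']).
generalize (H _ _ _ _ P R) (H _ _ _ _ Q R) (H _ _ _ _ P Q).
replace (x' + sg * dl - x' - (t' - t') * v (t', x')) with (sg * dl) by ring.
replace (t' - t') with 0 by ring; replace (x' + sg * dl - x') with (sg * dl) by ring.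
intros H1 H2 H3.
assert (Esg : Rabs (p (t', x') - p (t, x)) * dl = Rabs ((p (t', x') - p (t, x)) * (sg * dl))).
{ rewrite !Rabs_mult, (Rabs_right dl) by lra.
  replace (Rabs sg) with 1; [ring|]; destruct Hsg as [-> | ->]; unfold Rabs; destruct Rcase_abs; lra. }
assert (Hs2 : (sg * dl) ^ 2 = dl ^ 2) by (destruct Hsg as [-> | ->]; ring).
assert (Hsum : Rabs (p (t', x') - p (t, x)) * dl <= 6 * C * d ^ 2).
{ rewrite Esg.
  match type of H1 with Rabs ?a <= _ => match type of H2 with Rabs ?b <= _ =>
    match type of H3 with Rabs ?c <= _ =>
    replace ((p (t', x') - p (t, x)) * (sg * dl)) with (a + - b + - c) by ring end end end.
  eapply Rle_trans; [apply Rabs_triang|]; eapply Rle_trans; [apply Rplus_le_compat_r, Rabs_triang|].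
  rewrite !Rabs_Ropp; eapply Rle_trans; [apply Rplus_le_compat; [apply Rplus_le_compat|]; eassumption|].
  assert (Hk : (x' + sg * dl - x) ^ 2 <= 2 * (x' - x) ^ 2 + 2 * dl ^ 2).
  { rewrite <- Hs2; generalize (pow2_ge_0 (x' - x - sg * dl)); nra. }
  assert (Hdd : dl ^ 2 <= d ^ 2) by (apply pow_incr; nra).
  assert (Hhk : (t' - t) ^ 2 + (x' - x) ^ 2 <= d ^ 2).
  { unfold d; rewrite <- (pow2_abs (t' - t)), <- (pow2_abs (x' - x)); nra. }
  rewrite Hs2, (pow_ne_zero 2), <- !Rmult_plus_distr_l by lia.
  rewrite (Rmult_comm 6 C), Rmult_assoc; apply Rmult_le_compat_l; [exact C0|].
  generalize (pow2_ge_0 (t' - t)) (pow2_ge_0 (x' - x)); lra. }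
apply (Rmult_le_reg_r dl); [lra|]; eapply Rle_trans; [exact Hsum|].
right; rewrite Ed; ring.
Qed.

Lemma transport_taylor_comp T v z q C Q K h dh C1 B : 0 < T -> 0 <= C -> 0 <= C1 ->
  (forall t x, rect T (t, x) -> Rabs (q (t, x)) <= Q) -> rect_bounded T K v ->
  (forall y, Rabs (dh y) <= B) -> taylor (fun _ => True) h dh C1 ->
  transport_taylor T v z q C ->
  exists C', 0 <= C' /\
    transport_taylor T v (fun p => h (z p)) (fun p => dh (z p) * q p) C'.
Proof.
intros T0 C0 C10 HQ HK HB Hh Hz.
assert (P0 : rect T (0, 0)) by (split; simpl; lra).
assert (Q0 : 0 <= Q) by (eapply Rle_trans; [apply Rabs_pos|apply (HQ 0 0 P0)]).
assert (K0 : 0 <= K) by (eapply Rle_trans; [apply Rabs_pos|apply (HK 0 0 P0)]).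
assert (B0 : 0 <= B) by (eapply Rle_trans; [apply Rabs_pos|apply (HB 0)]).
(* A Lipschitz constant of [z]: the first term comes from the linear part, the second from the
   remainder, where increments are at most [T] and 1. *)
set (M := Q * (1 + K) + C * (T + 1)).
assert (M0 : 0 <= M) by (unfold M; nra).
exists (C1 * (2 * M ^ 2) + B * C); split; [generalize (pow2_ge_0 M); nra|].
intros t x t' x' P P'.
set (N := (t' - t) ^ 2 + (x' - x) ^ 2).
assert (N0 : 0 <= N) by (unfold N; generalize (pow2_ge_0 (t' - t)) (pow2_ge_0 (x' - x)); lra).
assert (Hz1 := Hz t x t' x' P P'); fold N in Hz1.
assert (Hb : 0 <= Rabs (t' - t) <= T /\ 0 <= Rabs (x' - x) <= 1).
{ destruct P as [P1 P2], P' as [Q1 Q2]; simpl in *.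
  unfold Rabs; repeat destruct Rcase_abs; lra. }
assert (Hd : Rabs (z (t', x') - z (t, x)) <= M * (Rabs (t' - t) + Rabs (x' - x))).
{ match type of Hz1 with Rabs (_ - ?l) <= _ =>
    replace (z (t', x') - z (t, x)) with ((z (t', x') - z (t, x) - l) + l) by ring;
    assert (Hl : Rabs l <= Q * (1 + K) * (Rabs (t' - t) + Rabs (x' - x))) end.
  { rewrite Rabs_mult, Rmult_assoc; apply Rmult_le_compat; try apply Rabs_pos; [now apply HQ|].
    eapply Rle_trans; [apply Rabs_triang|]; rewrite Rabs_Ropp, Rabs_mult.
    generalize (HK t x P) (Rabs_pos (v (t, x))); nra. }
  eapply Rle_trans; [apply Rabs_triang|]; unfold M; rewrite (Rmult_plus_distr_r (Q * (1 + K))), Rplus_comm.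
  apply Rplus_le_compat; [exact Hl|].
  eapply Rle_trans; [exact Hz1|]; rewrite Rmult_assoc; apply Rmult_le_compat_l; [exact C0|].
  unfold N; rewrite <- (pow2_abs (t' - t)), <- (pow2_abs (x' - x)); nra. }
assert (Hd2 : (z (t', x') - z (t, x)) ^ 2 <= 2 * M ^ 2 * N).
{ rewrite <- pow2_abs; eapply Rle_trans.
  - apply pow_incr; split; [apply Rabs_pos|exact Hd].
  - rewrite Rpow_mult_distr, (Rmult_comm 2), Rmult_assoc; apply Rmult_le_compat_l; [apply pow2_ge_0|].
    unfold N; rewrite <- (pow2_abs (t' - t)), <- (pow2_abs (x' - x)).
    generalize (pow2_ge_0 (Rabs (t' - t) - Rabs (x' - x))); nra. }
match type of Hz1 with Rabs ?e <= _ => match goal with |- Rabs ?g <= _ =>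
  replace g with ((h (z (t', x')) - h (z (t, x)) - dh (z (t, x)) * (z (t', x') - z (t, x)))
    + dh (z (t, x)) * e) by ring end end.
eapply Rle_trans; [apply Rabs_triang|]; rewrite Rabs_mult, Rmult_plus_distr_r.
apply Rplus_le_compat.
- eapply Rle_trans; [now apply Hh|]; rewrite Rmult_assoc; now apply Rmult_le_compat_l.
- rewrite Rmult_assoc; apply Rmult_le_compat; try apply Rabs_pos; auto.
Qed.

(** * Monotonicity, intermediate values and inversion from one-variable expansions *)

Lemma taylor_bounded m M h dh C x0 : 0 <= C -> seg m M x0 -> taylor (seg m M) h dh C ->
  forall x, seg m M x -> Rabs (dh x) <= Rabs (dh x0) + 2 * C * (M - m).
Proof.
intros C0 S0 H x Sx.
replace (dh x) with (dh x0 + (dh x - dh x0)) by ring.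
eapply Rle_trans; [apply Rabs_triang|]; apply Rplus_le_compat_l.
eapply Rle_trans; [apply (taylor_lipschitz _ _ _ _ x0 x H S0 Sx)|].
apply Rmult_le_compat_l; [lra|]; unfold seg in *; unfold Rabs; destruct Rcase_abs; lra.
Qed.

Lemma taylor_MVT m M h dh C : taylor (seg m M) h dh C ->
  forall x y, seg m M x -> seg m M y -> exists c,
    Rmin x y <= c <= Rmax x y /\ h y - h x = dh c * (y - x).
Proof.
intros H; apply MVT_seg; intros x Sx; now apply (derive_of_taylor _ _ _ C).
Qed.

Lemma taylor_nonincreasing m M h dh C : taylor (seg m M) h dh C ->
  (forall x, seg m M x -> dh x <= 0) ->
  forall x y, seg m M x -> seg m M y -> x <= y -> h y <= h x.
Proof.
intros H Hd x y Sx Sy Hxy; destruct (taylor_MVT m M h dh C H x y Sx Sy) as [c [Hc E]].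
rewrite Rmin_left, Rmax_right in Hc by lra.
assert (dh c <= 0) by (apply Hd; unfold seg in *; lra); nra.
Qed.

Lemma taylor_IVT m M h dh C y : m <= M -> taylor (seg m M) h dh C ->
  h M <= y <= h m -> exists s, seg m M s /\ h s = y.
Proof.
intros Hm H Hy.
assert (Sm : seg m M m) by (unfold seg; lra).
assert (SM : seg m M M) by (unfold seg; lra).
destruct (Rle_dec 0 C) as [C0|C0].
(* A negative [C] is compatible with the expansion between the endpoints only if they coincide. *)
2:{ assert (E : M = m).
    { destruct (Req_dec M m) as [|N]; [assumption|].
      generalize (H m M Sm SM) (Rabs_pos (h M - h m - dh m * (M - m))).
      assert (0 < (M - m) ^ 2) by (apply pow2_gt_0; lra); nra. }
    exists m; split; [exact Sm|]; subst; lra. }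
destruct (IVT_gen (fun s => h (clamp m M s)) m M y) as [s [Hs E]].
- intros x; apply continuity_pt_filterlim.
  apply (lipschitz_continuous (fun s => h (clamp m M s)) (Rabs (dh m) + 2 * C * (M - m))).
  clear x; intros x z.
  destruct (taylor_MVT m M h dh C H (clamp m M x) (clamp m M z)) as [c [Hc E]];
    try (apply clamp_seg; lra).
  rewrite E, Rabs_mult.
  assert (Sc : seg m M c).
  { generalize (clamp_seg m M x Hm) (clamp_seg m M z Hm); unfold seg; revert Hc.
    unfold Rmin, Rmax; destruct Rle_dec; lra. }
  apply Rmult_le_compat; try apply Rabs_pos; [|apply clamp_lipschitz].
  now apply (taylor_bounded m M h dh C m).
- rewrite !clamp_id by assumption; rewrite Rmin_right, Rmax_left by lra; exact Hy.
- rewrite Rmin_left, Rmax_right in Hs by lra; exists s; split; [exact Hs|].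
  now rewrite clamp_id in E.
Qed.

(* [h] is [a] composed with the inverse of the decreasing function [b]. *)
Lemma taylor_inverse_comp T b db a da C A beta : 0 < T -> 0 <= C -> 0 < beta ->
  taylor (seg 0 T) b db C -> (forall s, seg 0 T s -> db s <= - beta) ->
  taylor (seg 0 T) a da C -> (forall s, seg 0 T s -> Rabs (da s) <= A) ->
  exists h dh C', 0 <= C' /\ taylor (seg (b T) (b 0)) h dh C' /\
    forall s, seg 0 T s -> seg (b T) (b 0) (b s) /\ h (b s) = a s /\ dh (b s) = da s / db s.
Proof.
intros T0 C0 Hbeta Hb Hdb Ha HA.
assert (S0 : seg 0 T 0) by (unfold seg; lra).
assert (ST : seg 0 T T) by (unfold seg; lra).
assert (A0 : 0 <= A) by (eapply Rle_trans; [apply Rabs_pos|apply (HA 0 S0)]).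
assert (Hmono : forall s s', seg 0 T s -> seg 0 T s' -> s <= s' -> b s' <= b s).
{ apply (taylor_nonincreasing _ _ _ _ _ Hb); intros s Ss; generalize (Hdb s Ss); lra. }
assert (Hexp : forall s s', seg 0 T s -> seg 0 T s' -> beta * Rabs (s' - s) <= Rabs (b s' - b s)).
{ intros s s' Ss Ss'; destruct (taylor_MVT _ _ _ _ _ Hb s s' Ss Ss') as [c [Hc E]].
  rewrite E, Rabs_mult; apply Rmult_le_compat_r; [apply Rabs_pos|].
  assert (Sc : seg 0 T c).
  { unfold seg in *; revert Hc; unfold Rmin, Rmax; destruct Rle_dec; lra. }
  generalize (Hdb c Sc); intros; rewrite Rabs_left; lra. }
assert (Hinj : forall s s', seg 0 T s -> seg 0 T s' -> b s' = b s -> s' = s).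
{ intros s s' Ss Ss' E; generalize (Hexp s s' Ss Ss'); rewrite E, Rminus_diag, Rabs_R0; intros G.
  destruct (Req_dec (s' - s) 0) as [|N]; [lra|]; apply Rabs_pos_lt in N; nra. }
(* Choice asks for a value at every [y]; outside the range of [b] the relation is vacuous and 0 is a
   dummy. *)
destruct (functional_choice (fun y s => seg (b T) (b 0) y -> seg 0 T s /\ b s = y)) as [tau Htau].
{ intros y; destruct (Rle_dec (b T) y) as [H1|H1]; destruct (Rle_dec y (b 0)) as [H2|H2].
  - destruct (taylor_IVT 0 T b db C y) as [s Hs]; [lra|exact Hb|lra|exists s; auto].
  - exists 0; unfold seg; intros; lra.
  - exists 0; unfold seg; intros; lra.
  - exists 0; unfold seg; intros; lra. }
assert (Hbs : forall s, seg 0 T s -> seg (b T) (b 0) (b s)).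
{ intros s Ss; split; apply Hmono; auto; apply Ss. }
(* The remainder is that of [a], plus that of [b] times the slope [da / db], which is at most
   [A / beta]; dividing by [beta ^ 2] converts squared increments of [s] into those of [y]. *)
exists (fun y => a (tau y)), (fun y => da (tau y) / db (tau y)), ((C + A / beta * C) / beta ^ 2).
assert (HAb : 0 <= A / beta) by (apply Rdiv_le_0_compat; lra).
assert (Hb2 : 0 < beta ^ 2) by (apply pow_lt; lra).
split; [|split].
- apply Rdiv_le_0_compat; [nra|assumption].
- intros y y' Sy Sy'; destruct (Htau y Sy) as [Ss Es]; destruct (Htau y' Sy') as [Ss' Es'].
  set (s := tau y) in *; set (s' := tau y') in *.
  assert (Hdn := Hdb s Ss).
  replace (a s' - a s - da s / db s * (y' - y)) with
    ((a s' - a s - da s * (s' - s)) + - (da s / db s * (b s' - b s - db s * (s' - s))))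
    by (rewrite Es, Es'; field; lra).
  eapply Rle_trans; [apply Rabs_triang|]; rewrite Rabs_Ropp, Rabs_mult.
  assert (Hq : Rabs (da s / db s) <= A / beta).
  { unfold Rdiv; rewrite Rabs_mult, Rabs_inv; apply Rmult_le_compat; try apply Rabs_pos.
    - left; apply Rinv_0_lt_compat, Rabs_pos_lt; lra.
    - now apply HA.
    - apply Rinv_le_contravar; [lra|]; rewrite Rabs_left; lra. }
  apply Rle_trans with ((C + A / beta * C) * (s' - s) ^ 2).
  { rewrite Rmult_plus_distr_r; apply Rplus_le_compat; [now apply Ha|].
    rewrite Rmult_assoc; apply Rmult_le_compat; try apply Rabs_pos; auto. }
  unfold Rdiv at 2; rewrite Rmult_assoc; apply Rmult_le_compat_l; [nra|].
  apply (Rmult_le_reg_l (beta ^ 2)); [exact Hb2|].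
  rewrite <- Rmult_assoc, Rinv_r, Rmult_1_l, <- Rpow_mult_distr by lra.
  rewrite <- (pow2_abs (y' - y)), <- (pow2_abs (beta * (s' - s))); apply pow_incr.
  split; [apply Rabs_pos|]; rewrite Rabs_mult, (Rabs_right beta), <- Es, <- Es' by lra; auto.
- intros s Ss; split; [auto|].
  destruct (Htau (b s) (Hbs s Ss)) as [Ss' Es].
  rewrite (Hinj s (tau (b s)) Ss Ss' Es); auto.
Qed.

Lemma W2inf_taylor m M h : m <= M -> W2inf m M h -> exists dh C, 0 <= C /\
  taylor (seg m M) h dh C /\ forall x, seg m M x -> is_derive_within (seg m M) h x (dh x).
Proof.
intros Hm [dh [Hd [_ [L HL]]]]; exists dh, (Rabs L); split; [apply Rabs_pos|split; [|exact Hd]].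
apply taylor_of_derive; [exact Hd|]; intros x y Sx Sy.
eapply Rle_trans; [apply (HL y x Sy Sx)|].
apply Rmult_le_compat_r; [apply Rabs_pos|apply Rle_abs].
Qed.

Lemma seg_accumulation m M x : m < M -> seg m M x ->
  forall d, 0 < d -> exists y, seg m M y /\ 0 < Rabs (y - x) < d.
Proof.
intros Hm Sx d Hd; unfold seg in *.
set (e := Rmin (d / 2) ((M - m) / 2)).
assert (He : 0 < e) by (apply Rmin_glb_lt; lra).
generalize (Rmin_l (d / 2) ((M - m) / 2)) (Rmin_r (d / 2) ((M - m) / 2)); fold e; intros R1 R2.
destruct (Rle_dec x ((m + M) / 2)).
- exists (x + e); replace (x + e - x) with e by ring; rewrite Rabs_right; lra.
- exists (x - e); replace (x - e - x) with (- e) by ring; rewrite Rabs_left; lra.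
Qed.

(** * The solution on a rectangle *)

(** Compactness of [[0, T]] makes the positivity uniform, so that the inverse of [z (t, 0)] is
    Lipschitz up to time [T]. *)
Lemma inflow_speed_lower_bound v K T : 0 < T -> 0 <= K -> rect_lipschitz T K v ->
  (forall t, 0 <= t -> 0 < v (t, 0)) ->
  exists v0, 0 < v0 /\ forall t, 0 <= t <= T -> v0 <= v (t, 0).
Proof.
intros T0 K0 Lv Hpos.
destruct (continuity_ab_min (fun t => v (clamp 0 T t, 0)) 0 T) as [t0 [Ht0 S0]]; [lra| |].
- intros t _; apply continuity_pt_filterlim.
  apply (lipschitz_continuous (fun t => v (clamp 0 T t, 0)) K); intros s r.
  eapply Rle_trans.
  + apply Lv; split; simpl; try lra; apply clamp_seg; lra.
  + rewrite Rminus_diag, Rabs_R0, Rplus_0_r; apply Rmult_le_compat_l; [exact K0|].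
    apply clamp_lipschitz.
- exists (v (t0, 0)); split; [apply Hpos; lra|]; intros t Ht.
  generalize (Ht0 t Ht); rewrite !clamp_id by (unfold seg; lra); auto.
Qed.

(** The glued function is extended to the whole line so that composing it with [z] does not require
    tracking the range of [z]. *)
Lemma taylor_glue_functions m M h1 dh1 h2 dh2 C : m <= 0 <= M -> 0 <= C ->
  taylor (seg m 0) h1 dh1 C -> taylor (seg 0 M) h2 dh2 C ->
  h1 0 = h2 0 -> dh1 0 = dh2 0 ->
  exists h dh C', 0 <= C' /\ taylor (fun _ => True) h dh C' /\
    (forall y, Rabs (dh y) <= C') /\
    (forall y, seg m 0 y -> h y = h1 y) /\ (forall y, seg 0 M y -> h y = h2 y).
Proof.
intros Hm C0 H1 H2 E Ed.
set (h := fun y => if Rle_dec y 0 then h1 y else h2 y).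
set (dh := fun y => if Rle_dec y 0 then dh1 y else dh2 y).
assert (G1 : forall y, y <= 0 -> h y = h1 y /\ dh y = dh1 y).
{ intros y Hy; unfold h, dh; destruct Rle_dec; [auto|lra]. }
assert (G2 : forall y, 0 <= y -> h y = h2 y /\ dh y = dh2 y).
{ intros y Hy; unfold h, dh; destruct Rle_dec; [|auto].
  replace y with 0 by lra; auto. }
assert (HT : taylor (seg m M) h dh (3 * C)).
{ apply (taylor_glue _ _ _ C 0); [exact C0|exact Hm| |].
  - intros x y [Sx Hx] [Sy Hy].
    rewrite (proj1 (G1 x Hx)), (proj1 (G1 y Hy)), (proj2 (G1 x Hx)).
    unfold seg in *; apply H1; unfold seg; lra.
  - intros x y [Sx Hx] [Sy Hy].
    rewrite (proj1 (G2 x Hx)), (proj1 (G2 y Hy)), (proj2 (G2 x Hx)).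
    unfold seg in *; apply H2; unfold seg; lra. }
set (B := Rabs (dh 0) + 2 * (3 * C) * (M - m)).
assert (HB : forall y, seg m M y -> Rabs (dh y) <= B).
{ apply (taylor_bounded m M h dh (3 * C) 0); [lra|exact Hm|exact HT]. }
assert (B0 : 0 <= B) by (eapply Rle_trans; [apply Rabs_pos|apply (HB 0 Hm)]).
exists (ext m M h dh), (dext m M dh), (9 * (3 * C + B)).
split; [lra|split; [|split; [|split]]].
- apply ext_taylor; [lra| |].
  + apply (taylor_weaken _ _ _ (3 * C)); [lra|exact HT].
  + intros y Sy; generalize (HB y Sy); lra.
- intros y; apply Rle_trans with B; [|lra]; apply dext_bound; [lra|exact HB].
- intros y Sy; rewrite ext_id by (unfold seg in *; lra); apply G1, Sy.
- intros y Sy; rewrite ext_id by (unfold seg in *; lra); apply G2, Sy.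
Qed.

(** The last two clauses trace values of [w] back to the data. They are all that the sup bound and
    the extinction property need, so [z] does not appear beyond this lemma. *)
Lemma exists_rect_solution v phi a da0 dphi0 T :
  W2inf 0 1 phi -> (forall T, 0 < T -> W2inf 0 T a) -> a 0 = phi 0 ->
  is_derive_within half_line a 0 da0 ->
  is_derive_within (seg 0 1) phi 0 dphi0 ->
  da0 + v (0, 0) * dphi0 = 0 -> C1_loc_lipschitz v ->
  (forall t x, 0 <= t -> 0 <= x <= 1 -> 0 <= v (t, x)) ->
  (forall t, 0 <= t -> 0 < v (t, 0)) -> 0 < T ->
  exists w p C, 0 <= C /\ transport_taylor T v w p C /\
    (forall x, 0 <= x <= 1 -> w (0, x) = phi x) /\
    (forall t, 0 <= t <= T -> w (t, 0) = a t) /\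
    (forall t x, rect T (t, x) ->
      (exists y, 0 <= y <= 1 /\ w (t, x) = phi y) \/
      (exists s, 0 <= s <= t /\ w (t, x) = a s)) /\
    (forall vmin, 0 < vmin ->
      (forall t x, 0 <= t -> 0 <= x <= 1 -> vmin <= v (t, x)) ->
      forall t x, rect T (t, x) -> / vmin <= t -> exists s, 0 <= s <= t /\ w (t, x) = a s).
Proof.
intros Hphi Ha Hc0 Hda0 Hdphi0 Hc1 Hv Hnn Hpos T0.
destruct (exists_first_integral v T Hv T0) as [z [q [C [q0 [C0 [q00 [Hz0 [Hq1 [Hq Hz]]]]]]]]].
assert (Hest : exists K, 0 < K /\ rect_bounded T K v /\ rect_lipschitz T K v).
{ destruct Hv as [vt [vx [HC1 Hlip]]]; destruct (Hlip T T0) as [Hvt Hvx].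
  destruct (C1_rect_estimates v vt vx T HC1 T0 Hvt Hvx) as [K HK]; exists K; tauto. }
destruct Hest as [K [K0 [Bv Lv]]].
destruct (inflow_speed_lower_bound v K T T0 ltac:(lra) Lv Hpos) as [v0 [Hv0 Hv0t]].
destruct (W2inf_taylor 0 1 phi Rle_0_1 Hphi) as [dphi [Cphi [Cphi0 [Tphi Dphi]]]].
destruct (W2inf_taylor 0 T a ltac:(lra) (Ha T T0)) as [da [Ca [Ca0 [Ta Da]]]].
assert (S1 : seg 0 1 0) by (unfold seg; lra).
assert (S0 : seg 0 T 0) by (unfold seg; lra).
assert (ST : seg 0 T T) by (unfold seg; lra).
(* The slopes in the compatibility condition and those supplied by [W2inf] are a priori different
   witnesses; uniqueness of the one-sided derivative identifies them. *)
assert (Edphi : dphi 0 = dphi0).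
{ apply (is_derive_within_unique (seg 0 1) phi 0); auto.
  apply seg_accumulation; [lra|exact S1]. }
assert (Eda : da 0 = da0).
{ apply (is_derive_within_unique (seg 0 T) a 0); auto.
  - apply seg_accumulation; [lra|exact S0].
  - apply (is_derive_within_subset half_line); [exact S0| |exact Hda0].
    intros y Hy; apply Hy. }
set (b := fun t => z (t, 0)).
set (db := fun t => - (q (t, 0) * v (t, 0))).
assert (Tb : taylor (seg 0 T) b db C) by (apply (transport_taylor_slice_t T v); [lra|exact Hz]).
assert (Hqt : forall t x, rect T (t, x) -> 0 < q (t, x)) by (intros t x P; generalize (Hq t x P); lra).
assert (Hdb : forall s, seg 0 T s -> db s <= - (q0 * v0)).
{ intros s Ss; unfold db; apply Ropp_le_contravar; apply Rmult_le_compat; try lra.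
  - apply (Hq s 0); split; [exact Ss|simpl; lra].
  - apply Hv0t, Ss. }
assert (Hb0 : b 0 = 0) by apply Hz0.
assert (Hbeta : 0 < q0 * v0) by (apply Rmult_lt_0_compat; assumption).
destruct (taylor_inverse_comp T b db a da (C + Ca) (Rabs (da 0) + 2 * Ca * (T - 0)) (q0 * v0))
  as [h1 [dh1 [C1 [C10 [Th1 Hh1]]]]]; try assumption; try lra.
{ apply (taylor_weaken _ _ _ C); [lra|exact Tb]. }
{ apply (taylor_weaken _ _ _ Ca); [lra|exact Ta]. }
{ now apply (taylor_bounded 0 T a da Ca 0). }
destruct (Hh1 0 S0) as [_ [Eh1 Edh1]].
rewrite Hb0 in Th1, Eh1, Edh1.
assert (HbT : b T <= 0) by (destruct (Hh1 T ST) as [[_ H] _]; lra).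
destruct (taylor_glue_functions (b T) 1 h1 dh1 phi dphi (C1 + Cphi))
  as [h [dh [Ch [Ch0 [Th [Bh [Hhl Hhr]]]]]]]; try lra.
{ apply (taylor_weaken _ _ _ C1); [lra|exact Th1]. }
{ apply (taylor_weaken _ _ _ Cphi); [lra|exact Tphi]. }
(* At 0 the left slope is [da0 / db 0], and [db 0 = - v (0, 0)] because [q = 1] at time 0; the
   compatibility condition says that this quotient is [dphi0]. *)
{ rewrite Edh1, Edphi, Eda; unfold db; rewrite Hq1.
  generalize (Hpos 0 (Rle_refl 0)); intros Hp0.
  replace da0 with (- (v (0, 0) * dphi0)) by lra; field; lra. }
destruct (transport_taylor_comp T v z q C (/ q0) K h dh Ch Ch) as [C' [C'0 HC']]; auto.
{ intros t x P; generalize (Hq t x P) (Hqt t x P); intros; rewrite Rabs_right; lra. }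
assert (Hha : forall s, seg 0 T s -> h (b s) = a s).
{ intros s Ss; destruct (Hh1 s Ss) as [Hbs [E _]]; rewrite Hb0 in Hbs; rewrite Hhl; auto. }
(* For fixed [x], [z] starts from [x] and has time slope [- q v <= 0]. The next bound uses instead
   that, for fixed [t], [z] increases in [x] from [b t]. *)
assert (Hzx : forall t x, rect T (t, x) -> z (t, x) <= x).
{ intros t x [P1 P2]; simpl in *; rewrite <- (Hz0 x) at 2.
  apply (taylor_nonincreasing 0 T (fun t => z (t, x)) (fun t => - (q (t, x) * v (t, x))) C);
    [now apply (transport_taylor_slice_t T v)| |exact S0|exact P1|lra].
  intros s Ss; assert (0 < q (s, x)) by (apply Hqt; split; assumption).
  assert (0 <= v (s, x)) by (apply Hnn; [apply Ss|exact P2]); nra. }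
assert (Hzb : forall t x, rect T (t, x) -> b t <= z (t, x)).
{ intros t x [P1 P2]; simpl in *.
  assert (Tx := transport_taylor_slice_x T v z q C t P1 Hz).
  destruct (taylor_MVT _ _ _ _ _ Tx 0 x S1 P2) as [c [Hc E]].
  rewrite Rmin_left, Rmax_right in Hc by lra.
  assert (0 < q (t, c)) by (apply Hqt; split; simpl; lra); unfold b; nra. }
(* Because [b t <= z (t, x)], the intermediate value is found on [[0, t]] and not merely on
   [[0, T]]; only past boundary data count, as the maximum over [0 <= s <= t] demands. *)
assert (Hneg : forall t x, rect T (t, x) -> z (t, x) <= 0 -> exists s, 0 <= s <= t /\ h (z (t, x)) = a s).
{ intros t x P Hle; assert (P' := P); destruct P' as [P1 P2]; simpl in *.
  destruct (taylor_IVT 0 t b db C (z (t, x))) as [s [Ss E]].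
  - lra.
  - intros s s' Ss Ss'; apply Tb; unfold seg in *; lra.
  - rewrite Hb0; split; [now apply Hzb|exact Hle].
  - exists s; split; [exact Ss|]; rewrite <- E; apply Hha; unfold seg in *; lra. }
exists (fun p => h (z p)), (fun p => dh (z p) * q p), C'.
split; [exact C'0|split; [exact HC'|split; [|split; [|split]]]].
- intros x Hx; rewrite Hz0; now apply Hhr.
- intros t Ht; now apply Hha.
- intros t x P; destruct (Rle_dec (z (t, x)) 0) as [Hle|Hgt].
  + right; now apply Hneg.
  + left; exists (z (t, x)).
    assert (0 <= z (t, x) <= 1) by (generalize (Hzx t x P); destruct P as [_ P2]; simpl in P2; lra).
    split; [assumption|]; now apply Hhr.
- intros vm Hvm Hvmin t x P Ht; apply Hneg; [exact P|].
  assert (P' := P); destruct P' as [P1 P2]; simpl in P1, P2.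
  assert (Hi : 0 < / vm) by now apply Rinv_0_lt_compat.
  (* The time at which the ray of speed [vm] through [(t, x)] starts from [x = 0]; it is nonnegative
     because [/ vm <= t] and [x <= 1]. Along the ray, parametrised by [x], the slope of [z] is
     [q * (1 - v / vm) <= 0], so [z (t, x) <= b s0 <= b 0]. *)
  set (s0 := t - / vm * x).
  assert (Hs0 : 0 <= s0 <= T) by (unfold s0; nra).
  assert (Hb' : b s0 <= 0).
  { rewrite <- Hb0; apply (taylor_nonincreasing _ _ _ _ _ Tb); auto; [|lra].
    intros s Ss; generalize (Hdb s Ss); lra. }
  apply Rle_trans with (b s0); [|exact Hb'].
  assert (Hray : forall r, seg 0 x r -> rect T (s0 + / vm * r, r)).
  { intros r [R1 R2]; split; simpl; [|lra]; unfold s0.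
    assert (/ vm * r <= / vm * x) by (apply Rmult_le_compat_l; lra).
    assert (0 <= / vm * r) by (apply Rmult_le_pos; lra); unfold s0 in Hs0; lra. }
  replace (z (t, x)) with (z (s0 + / vm * x, x)) by (do 2 f_equal; unfold s0; ring).
  replace (b s0) with (z (s0 + / vm * 0, 0)) by (unfold b; do 2 f_equal; ring).
  apply (taylor_nonincreasing 0 x (fun r => z (s0 + / vm * r, r))
    (fun r => q (s0 + / vm * r, r) * (1 - / vm * v (s0 + / vm * r, r))) (C * ((/ vm) ^ 2 + 1)));
    try (unfold seg; lra).
  + intros r r' Sr Sr'; generalize (Hz _ _ _ _ (Hray r Sr) (Hray r' Sr')).
    match goal with |- Rabs ?a <= ?c -> Rabs ?b <= ?d => replace b with a by ring; replace d with c by ring end.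
    auto.
  + intros r Sr; generalize (Hqt _ _ (Hray r Sr)); intros Hqr.
    assert (vm <= v (s0 + / vm * r, r)).
    { apply Hvmin; destruct (Hray r Sr) as [[R1 _] R2]; assumption. }
    assert (1 <= / vm * v (s0 + / vm * r, r)).
    { rewrite <- (Rinv_l vm) by lra; apply Rmult_le_compat_l; lra. }
    nra.
Qed.

(** * Maximum principle and uniqueness *)

Definition near (d : R) (p q : R * R) : Prop :=
  Rabs (fst q - fst p) < d /\ Rabs (snd q - snd p) < d.

(** Compactness as a uniform lower bound for radii: every [q] is near some [p] whose own radius is
    at least [d0]. Whatever [P] says in terms of the radius thereby becomes uniform. *)
Lemma rect_uniform T (P : R * R -> R -> Prop) :
  (forall p, rect T p -> exists d, 0 < d /\ P p d) ->
  exists d0, 0 < d0 /\ forall q, rect T q ->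
    exists p d, rect T p /\ near d p q /\ d0 <= d /\ P p d.
Proof.
intros H.
destruct (functional_choice (fun p (d : posreal) => rect T p -> P p d)) as [delta Hdelta].
{ intros p; destruct (classic (rect T p)) as [R|N].
  - destruct (H p R) as [d [Hd HP]]; now exists (mkposreal d Hd).
  - exists (mkposreal 1 Rlt_0_1); tauto. }
destruct (compactness_value_2d 0 T 0 1 (fun u v => delta (u, v))) as [d Hd].
exists d; split; [apply cond_pos|]; intros [t x] [Ht Hx]; simpl in *.
destruct (NNPP _ (Hd t x Ht Hx)) as [u [y [Hu [Hy [H1 [H2 H3]]]]]].
exists (u, y), (delta (u, y)); split; [split; assumption|].
split; [split; assumption|]; split; [exact H3|]; apply Hdelta; split; assumption.
Qed.

(** The hypothesis is upper semicontinuity. Compactness serves twice: to bound [psi], then to show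
    that an unattained supremum could be lowered. *)
Lemma rect_attains_max T psi : 0 <= T ->
  (forall p, rect T p -> forall eps, 0 < eps -> exists d, 0 < d /\
     forall q, rect T q -> near d p q -> psi q <= psi p + eps) ->
  exists p, rect T p /\ forall q, rect T q -> psi q <= psi p.
Proof.
intros T0 H.
(* The first condition bounds [psi p] in terms of [/ d], so a lower bound on the radius becomes an
   upper bound on [psi]. *)
destruct (rect_uniform T (fun p d => d * (1 + Rabs (psi p)) <= 1 /\
  forall q, rect T q -> near d p q -> psi q <= psi p + 1)) as [d0 [Hd0 Hb]].
{ intros p R; destruct (H p R 1 Rlt_0_1) as [d [Hd HP]].
  assert (A : 0 < 1 + Rabs (psi p)) by (generalize (Rabs_pos (psi p)); lra).
  exists (Rmin d (/ (1 + Rabs (psi p)))); split.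
  { apply Rmin_glb_lt; [exact Hd|now apply Rinv_0_lt_compat]. }
  split.
  - apply Rle_trans with (/ (1 + Rabs (psi p)) * (1 + Rabs (psi p))); [|right; field; lra].
    apply Rmult_le_compat_r; [lra|apply Rmin_r].
  - intros q Rq [N1 N2]; apply HP; [exact Rq|].
    generalize (Rmin_l d (/ (1 + Rabs (psi p)))); split; lra. }
assert (Hbound : forall q, rect T q -> psi q <= / d0 + 1).
{ intros q Rq; destruct (Hb q Rq) as [p [d [Rp [Hn [Hd [Hd1 HP]]]]]].
  eapply Rle_trans; [exact (HP q Rq Hn)|]; apply Rplus_le_compat_r.
  apply Rle_trans with (1 + Rabs (psi p)); [generalize (Rle_abs (psi p)); lra|].
  apply (Rmult_le_reg_l d0); [exact Hd0|]; rewrite Rinv_r by lra.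
  generalize (Rabs_pos (psi p)); nra. }
assert (R0 : rect T (0, 0)) by (split; simpl; lra).
destruct (completeness (fun y => exists q, rect T q /\ y = psi q)) as [M [HM1 HM2]].
{ exists (/ d0 + 1); intros y [q [Rq ->]]; auto. }
{ exists (psi (0, 0)), (0, 0); auto. }
destruct (classic (exists p, rect T p /\ psi p = M)) as [[p [Rp E]]|N].
{ exists p; split; [exact Rp|]; intros q Rq; rewrite E; apply HM1; exists q; auto. }
exfalso.
assert (HMlt : forall p, rect T p -> psi p < M).
{ intros p Rp; assert (psi p <= M) by (apply HM1; exists p; auto).
  destruct (Req_dec (psi p) M); [exfalso; apply N; exists p; auto|lra]. }
(* Here the radius is also the gap below [M]; its uniform lower bound [d1] makes [M - d1] an upper
   bound of [psi], against the choice of [M]. *)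
destruct (rect_uniform T (fun p d => forall q, rect T q -> near d p q -> psi q <= M - d))
  as [d1 [Hd1 Hc]].
{ intros p Rp; assert (G := HMlt p Rp).
  destruct (H p Rp ((M - psi p) / 2) ltac:(lra)) as [d [Hd HP]].
  exists (Rmin d ((M - psi p) / 2)); split; [apply Rmin_glb_lt; lra|].
  intros q Rq [N1 N2].
  generalize (Rmin_l d ((M - psi p) / 2)) (Rmin_r d ((M - psi p) / 2)); intros.
  assert (psi q <= psi p + (M - psi p) / 2) by (apply HP; [exact Rq|split; lra]); lra. }
assert (M <= M - d1); [|lra].
apply HM2; intros y [q [Rq ->]]; destruct (Hc q Rq) as [p [d [Rp [Hn [Hd HP]]]]].
generalize (HP q Rq Hn); lra.
Qed.

Lemma is_grad_within_subset (D D' : R * R -> Prop) f t x lt lx : D' (t, x) ->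
  (forall p, D' p -> D p) -> is_grad_within D f (t, x) lt lx -> is_grad_within D' f (t, x) lt lx.
Proof.
intros Dx HD H; rewrite is_grad_within_iff in H by auto.
apply is_grad_within_iff; [exact Dx|]; intros eps Heps.
destruct (H eps Heps) as [d [Hd0 Hd]]; exists d; split; [exact Hd0|]; auto.
Qed.

Lemma is_grad_within_minus D f g t x ft fx gt gx : D (t, x) ->
  is_grad_within D f (t, x) ft fx -> is_grad_within D g (t, x) gt gx ->
  is_grad_within D (fun p => f p - g p) (t, x) (ft - gt) (fx - gx).
Proof.
intros Dx Hf Hg; rewrite is_grad_within_iff in Hf, Hg by exact Dx.
apply is_grad_within_iff; [exact Dx|]; intros eps Heps.
destruct (Hf (eps / 2) ltac:(lra)) as [d [Hd0 Hd]].
destruct (Hg (eps / 2) ltac:(lra)) as [e [He0 He]].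
exists (Rmin d e); split; [now apply Rmin_glb_lt|]; intros t' x' D' Ht Hx.
generalize (Rmin_l d e) (Rmin_r d e); intros R1 R2.
generalize (Hd t' x' D' ltac:(lra) ltac:(lra)) (He t' x' D' ltac:(lra) ltac:(lra)).
match goal with |- Rabs ?a <= _ -> Rabs ?b <= _ -> Rabs ?c <= _ => replace c with (a + - b) by ring;
  generalize (Rabs_triang a (- b)); rewrite (Rabs_Ropp b) end; lra.
Qed.

(* At a positive maximum of u - e t both one-sided derivatives u_t - e and u_x
   are nonnegative, even at x = 1 or t = T, which v >= 0 makes incompatible with
   the equation. *)
Lemma transport_max_principle T v u ut ux : 0 < T ->
  (forall p, rect T p -> is_grad_within (rect T) u p (ut p) (ux p)) ->
  (forall t x, rect T (t, x) -> ut (t, x) + v (t, x) * ux (t, x) = 0) ->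
  (forall t x, rect T (t, x) -> 0 <= v (t, x)) ->
  (forall x, 0 <= x <= 1 -> u (0, x) <= 0) ->
  (forall t, 0 <= t <= T -> u (t, 0) <= 0) ->
  forall p, rect T p -> u p <= 0.
Proof.
intros T0 Hg Heq Hv Hu0 Hub p1 R1.
apply Rnot_lt_le; intros Hpos.
(* Small enough that [psi p1 >= u p1 / 2 > 0]: the maximum of [psi] is then positive, hence not at
   [t = 0] or [x = 0], and there is room to step back in both variables. *)
set (e := u p1 / (2 * T)).
assert (He : 0 < e) by (apply Rdiv_lt_0_compat; lra).
set (psi := fun p : R * R => u p - e * fst p).
destruct (rect_attains_max T psi ltac:(lra)) as [[t x] [R HM]].
{ intros [t x] R eps Heps.
  assert (G := Hg (t, x) R); rewrite is_grad_within_iff in G by exact R.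
  destruct (G 1 Rlt_0_1) as [d [Hd0 Hd]].
  set (B := 2 + Rabs (ut (t, x)) + Rabs (ux (t, x)) + e).
  assert (HB : 0 < B) by (unfold B; generalize (Rabs_pos (ut (t, x))) (Rabs_pos (ux (t, x))); lra).
  exists (Rmin d (eps / B)); split; [apply Rmin_glb_lt; [exact Hd0|now apply Rdiv_lt_0_compat]|].
  intros [t' x'] R' [N1 N2]; simpl in N1, N2; unfold psi; simpl.
  generalize (Rmin_l d (eps / B)) (Rmin_r d (eps / B)); intros M1 M2.
  generalize (Hd t' x' R' ltac:(lra) ltac:(lra)); intros G1.
  apply Rabs_le_between in G1; destruct G1 as [_ G1].
  assert (Hr : B * Rmin d (eps / B) <= eps).
  { apply Rle_trans with (B * (eps / B)); [apply Rmult_le_compat_l; lra|right; field; lra]. }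
  set (r := Rmin d (eps / B)) in *.
  assert (Rabs ((t' - t) * ut (t, x)) <= r * Rabs (ut (t, x))).
  { rewrite Rabs_mult; apply Rmult_le_compat_r; [apply Rabs_pos|lra]. }
  assert (Rabs ((x' - x) * ux (t, x)) <= r * Rabs (ux (t, x))).
  { rewrite Rabs_mult; apply Rmult_le_compat_r; [apply Rabs_pos|lra]. }
  generalize (Rle_abs ((t' - t) * ut (t, x))) (Rle_abs ((x' - x) * ux (t, x))); intros.
  assert (e * (t - t') <= e * r).
  { apply Rmult_le_compat_l; [lra|]; apply Rabs_def2 in N1; lra. }
  unfold B in Hr; lra. }
assert (Hpsi : 0 < psi (t, x)).
{ apply Rlt_le_trans with (psi p1); [|now apply HM]; unfold psi.
  assert (e * fst p1 <= u p1 / 2); [|lra].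
  apply Rle_trans with (e * T); [apply Rmult_le_compat_l; [lra|apply R1]|].
  right; unfold e; field; lra. }
assert (P := R); destruct P as [P1 P2]; simpl in P1, P2; unfold psi in Hpsi; simpl in Hpsi.
assert (Het : 0 <= e * t) by (apply Rmult_le_pos; lra).
assert (Ht : 0 < t).
{ destruct (Req_dec t 0) as [E|]; [|lra]; subst t; generalize (Hu0 x P2); lra. }
assert (Hx : 0 < x).
{ destruct (Req_dec x 0) as [E|]; [|lra]; subst x; generalize (Hub t P1); lra. }
assert (G := Hg (t, x) R); rewrite is_grad_within_iff in G by exact R.
assert (Hut : 0 < ut (t, x)).
{ destruct (G (e / 2) ltac:(lra)) as [d [Hd0 Hd]].
  set (h := Rmin (d / 2) t).
  assert (Hh : 0 < h) by (apply Rmin_glb_lt; lra).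
  generalize (Rmin_l (d / 2) t) (Rmin_r (d / 2) t); fold h; intros M1 M2.
  assert (R' : rect T (t - h, x)) by (split; simpl; lra).
  generalize (HM _ R'); unfold psi; simpl; intros HM'.
  generalize (Hd (t - h) x R'); replace (t - h - t) with (- h) by ring.
  rewrite Rminus_diag, Rabs_Ropp, Rabs_R0, (Rabs_right h) by lra; intros G1.
  specialize (G1 ltac:(lra) ltac:(lra)); apply Rabs_le_between in G1; nra. }
assert (Hux : 0 <= ux (t, x)).
{ apply Rnot_lt_le; intros Hneg.
  destruct (G (- ux (t, x) / 2) ltac:(lra)) as [d [Hd0 Hd]].
  set (h := Rmin (d / 2) x).
  assert (Hh : 0 < h) by (apply Rmin_glb_lt; lra).
  generalize (Rmin_l (d / 2) x) (Rmin_r (d / 2) x); fold h; intros M1 M2.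
  assert (R' : rect T (t, x - h)) by (split; simpl; lra).
  generalize (HM _ R'); unfold psi; simpl; intros HM'.
  generalize (Hd t (x - h) R'); replace (x - h - x) with (- h) by ring.
  rewrite Rminus_diag, Rabs_Ropp, Rabs_R0, (Rabs_right h) by lra; intros G1.
  specialize (G1 ltac:(lra) ltac:(lra)); apply Rabs_le_between in G1; nra. }
generalize (Heq t x R) (Hv t x R); nra.
Qed.

(** A common form for the constructed functions and for an arbitrary competitor restricted to a
    rectangle, tailored to the maximum principle. *)
Definition rect_solution (T : R) (v : R * R -> R) (w : R * R -> R) : Prop :=
  exists wt wx : R * R -> R,
    (forall p, rect T p -> is_grad_within (rect T) w p (wt p) (wx p)) /\
    (forall t x, rect T (t, x) -> wt (t, x) + v (t, x) * wx (t, x) = 0).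

Lemma rect_solution_unique T v w1 w2 : 0 < T ->
  (forall t x, rect T (t, x) -> 0 <= v (t, x)) ->
  rect_solution T v w1 -> rect_solution T v w2 ->
  (forall x, 0 <= x <= 1 -> w1 (0, x) = w2 (0, x)) ->
  (forall t, 0 <= t <= T -> w1 (t, 0) = w2 (t, 0)) ->
  forall p, rect T p -> w1 p = w2 p.
Proof.
intros T0 Hv H1 H2 E0 Eb p R.
enough (Hle : forall w1 w2, rect_solution T v w1 -> rect_solution T v w2 ->
  (forall x, 0 <= x <= 1 -> w1 (0, x) = w2 (0, x)) ->
  (forall t, 0 <= t <= T -> w1 (t, 0) = w2 (t, 0)) -> w1 p <= w2 p).
{ apply Rle_antisym; apply Hle; auto; intros; symmetry; auto. }
clear w1 w2 H1 H2 E0 Eb; intros w1 w2 [wt1 [wx1 [G1 Q1]]] [wt2 [wx2 [G2 Q2]]] E0 Eb.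
enough (w1 p - w2 p <= 0) by lra.
apply (transport_max_principle T v (fun p => w1 p - w2 p)
  (fun p => wt1 p - wt2 p) (fun p => wx1 p - wx2 p)); auto.
- intros [t x] R'; apply is_grad_within_minus; auto.
- intros t x R'; generalize (Q1 t x R') (Q2 t x R'); intros; lra.
- intros x Hx; rewrite E0 by exact Hx; lra.
- intros t Ht; rewrite Eb by exact Ht; lra.
Qed.

(** [D] will be [rect T] itself for uniqueness, and [half_strip] with [T = t + 1] for the global
    solution; as a gradient is local, a margin of 1 in time suffices. *)
Lemma transport_taylor_grad (D : R * R -> Prop) T v w p C t x : 0 <= C -> D (t, x) ->
  (forall t' x', D (t', x') -> Rabs (t' - t) < 1 -> rect T (t', x')) ->
  transport_taylor T v w p C ->
  is_grad_within D w (t, x) (- (v (t, x) * p (t, x))) (p (t, x)).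
Proof.
intros C0 Dx HD H; apply is_grad_within_iff; [exact Dx|]; intros eps Heps.
assert (R : rect T (t, x)) by (apply HD; [exact Dx|rewrite Rminus_diag, Rabs_R0; lra]).
assert (Hp : 0 < eps / (C + 1)) by (apply Rdiv_lt_0_compat; lra).
exists (Rmin 1 (eps / (C + 1))); split; [apply Rmin_glb_lt; lra|].
intros t' x' D' Ht Hx.
generalize (Rmin_l 1 (eps / (C + 1))) (Rmin_r 1 (eps / (C + 1))); intros M1 M2.
generalize (H t x t' x' R (HD t' x' D' ltac:(lra))).
match goal with |- Rabs ?a <= _ -> Rabs ?b <= _ => replace b with a by ring end.
intros G; eapply Rle_trans; [exact G|].
assert (E : C * (eps / (C + 1)) <= eps).
{ apply Rle_trans with ((C + 1) * (eps / (C + 1))); [apply Rmult_le_compat_r; lra|right; field; lra]. }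
rewrite <- (pow2_abs (t' - t)), <- (pow2_abs (x' - x)).
generalize (Rabs_pos (t' - t)) (Rabs_pos (x' - x)); intros.
assert (C * Rabs (t' - t) <= eps) by (eapply Rle_trans; [|exact E]; apply Rmult_le_compat_l; lra).
assert (C * Rabs (x' - x) <= eps) by (eapply Rle_trans; [|exact E]; apply Rmult_le_compat_l; lra).
nra.
Qed.

Lemma transport_taylor_restrict T T' v w p C : T' <= T ->
  transport_taylor T v w p C -> transport_taylor T' v w p C.
Proof.
intros HT H t x t' x' [P1 P2] [Q1 Q2]; simpl in *; apply H; split; simpl; lra.
Qed.

Lemma transport_taylor_solution T v w p C : 0 <= C -> transport_taylor T v w p C ->
  rect_solution T v w.
Proof.
intros C0 H; exists (fun q => - (v q * p q)), p; split.
- intros [t x] R; apply (transport_taylor_grad _ T v w p C); auto.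
- intros t x _; ring.
Qed.

Lemma loc_lipschitz_continuous_on f :
  (forall T, 0 < T -> exists L, 0 <= L /\ rect_lipschitz T L f) -> continuous_on half_strip f.
Proof.
intros H [t x] [Ht Hx]; simpl in *.
destruct (H (t + 1) ltac:(lra)) as [L [L0 HL]].
intros P [eps HP].
assert (Hp : 0 < eps / (2 * (L + 1))) by (apply Rdiv_lt_0_compat; [apply cond_pos|lra]).
assert (Hm : 0 < Rmin 1 (eps / (2 * (L + 1)))) by (apply Rmin_glb_lt; lra).
exists (mkposreal _ Hm); intros [t' x'] [N1 N2] [Ht' Hx']; simpl in *.
apply HP.
change (Rabs (t' - t) < Rmin 1 (eps / (2 * (L + 1)))) in N1.
change (Rabs (x' - x) < Rmin 1 (eps / (2 * (L + 1)))) in N2.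
generalize (Rmin_l 1 (eps / (2 * (L + 1)))) (Rmin_r 1 (eps / (2 * (L + 1)))); intros M1 M2.
change (Rabs (f (t', x') - f (t, x)) < eps).
eapply Rle_lt_trans; [apply HL; split; simpl; try lra|].
{ apply Rabs_def2 in N1; lra. }
apply Rlt_le_trans with ((L + 1) * (2 * (eps / (2 * (L + 1))))); [|right; field; lra].
generalize (Rabs_pos (t' - t)) (Rabs_pos (x' - x)); intros.
apply Rle_lt_trans with ((L + 1) * (Rabs (t' - t) + Rabs (x' - x))); [nra|].
apply Rmult_lt_compat_l; lra.
Qed.

(** [real] sends infinite values to 0. The bound excludes an infinite supremum, and [m <= M]
    excludes the empty set, whose supremum is minus infinity. *)
Lemma sup_abs_le m M f B : m <= M -> (forall x, seg m M x -> Rabs (f x) <= B) ->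
  sup_abs m M f <= B.
Proof.
intros Hm H; unfold sup_abs.
assert (G := Lub_Rbar_correct (fun y => exists x, seg m M x /\ y = Rabs (f x))).
destruct G as [G1 G2].
assert (L1 : Rbar_le (Lub_Rbar (fun y => exists x, seg m M x /\ y = Rabs (f x))) B).
{ apply G2; intros y [x [Sx ->]]; exact (H x Sx). }
assert (L2 := G1 (Rabs (f m)) (ex_intro _ m (conj (conj (Rle_refl m) Hm) eq_refl))).
destruct (Lub_Rbar _); simpl in *; [exact L1|contradiction|contradiction].
Qed.

(** The value of [B] is irrelevant; its existence keeps the supremum finite, so that [real] does not
    collapse it to 0. *)
Lemma le_sup_abs m M f B x : (forall x, seg m M x -> Rabs (f x) <= B) ->
  seg m M x -> Rabs (f x) <= sup_abs m M f.
Proof.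
intros H Sx; unfold sup_abs.
assert (G := Lub_Rbar_correct (fun y => exists x, seg m M x /\ y = Rabs (f x))).
destruct G as [G1 G2].
assert (L1 : Rbar_le (Lub_Rbar (fun y => exists x, seg m M x /\ y = Rabs (f x))) B).
{ apply G2; intros y [z [Sz ->]]; exact (H z Sz). }
assert (L2 := G1 (Rabs (f x)) (ex_intro _ x (conj Sx eq_refl))).
destruct (Lub_Rbar _); simpl in *; [exact L2|contradiction|contradiction].
Qed.

Lemma taylor_values_bounded m M h dh C : m <= M -> 0 <= C -> taylor (seg m M) h dh C ->
  exists B, forall x, seg m M x -> Rabs (h x) <= B.
Proof.
intros Hm C0 H; exists (Rabs (h m) + (Rabs (dh m) * (M - m) + C * (M - m) ^ 2)).
intros x Sx; assert (Sm : seg m M m) by (unfold seg; lra).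
replace (h x) with (h m + (dh m * (x - m) + (h x - h m - dh m * (x - m)))) by ring.
eapply Rle_trans; [apply Rabs_triang|]; apply Rplus_le_compat_l.
eapply Rle_trans; [apply Rabs_triang|]; rewrite Rabs_mult.
unfold seg in Sx; apply Rplus_le_compat.
- apply Rmult_le_compat_l; [apply Rabs_pos|]; rewrite Rabs_right; lra.
- eapply Rle_trans; [apply H; [exact Sm|exact Sx]|].
  apply Rmult_le_compat_l; [exact C0|]; apply pow_incr; lra.
Qed.

(** * Solution on the half-strip *)

(** The values on a time slice determine the slope there; thus the slopes obtained for different [T]
    agree as soon as the solutions do, and can be glued with them. *)
Lemma transport_taylor_slope_unique T v w1 w2 p1 p2 C1 C2 t x :
  transport_taylor T v w1 p1 C1 -> transport_taylor T v w2 p2 C2 ->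
  rect T (t, x) -> (forall y, 0 <= y <= 1 -> w1 (t, y) = w2 (t, y)) ->
  p1 (t, x) = p2 (t, x).
Proof.
intros H1 H2 [Ht Hx] E; simpl in *.
apply (is_derive_within_unique (seg 0 1) (fun y => w1 (t, y)) x); [exact Hx| | |].
- apply seg_accumulation; [lra|exact Hx].
- apply (derive_of_taylor _ _ (fun y => p1 (t, y)) C1); [exact Hx|].
  now apply (transport_taylor_slice_x T v).
- apply (derive_of_taylor _ _ (fun y => p2 (t, y)) C2); [exact Hx|].
  intros y z Sy Sz; rewrite !E by assumption.
  now apply (transport_taylor_slice_x T v w2 p2 C2 t Ht H2).
Qed.

Lemma rect_lipschitz_opp_mult T A B K L f g : 0 <= A -> 0 <= K ->
  rect_bounded T A f -> rect_lipschitz T B f -> rect_bounded T K g -> rect_lipschitz T L g ->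
  rect_lipschitz T (A * L + B * K) (fun p => - (f p * g p)).
Proof.
intros A0 K0 Af Bf Kg Lg t x t' x' P P'.
replace (- (f (t', x') * g (t', x')) - - (f (t, x) * g (t, x))) with
  (- (f (t', x') * (g (t', x') - g (t, x)) + (f (t', x') - f (t, x)) * g (t, x))) by ring.
rewrite Rabs_Ropp; eapply Rle_trans; [apply Rabs_triang|]; rewrite !Rabs_mult.
rewrite Rmult_plus_distr_r; apply Rplus_le_compat.
- rewrite Rmult_assoc; apply Rmult_le_compat; try apply Rabs_pos; auto.
- replace (B * K * (Rabs (t' - t) + Rabs (x' - x))) with (B * (Rabs (t' - t) + Rabs (x' - x)) * K) by ring.
  apply Rmult_le_compat; try apply Rabs_pos; auto.
Qed.

Theorem proposition5p2
  (v : R * R -> R) (phi a : R -> R) (da0 dphi0 : R)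
  (Hphi : W2inf 0 1 phi)
  (Ha : forall T, 0 < T -> W2inf 0 T a)
  (Hcompat0 : a 0 = phi 0)
  (Hda0 : is_derive_within half_line a 0 da0)
  (Hdphi0 : is_derive_within (seg 0 1) phi 0 dphi0)
  (Hcompat1 : da0 + v (0, 0) * dphi0 = 0)
  (Hv : C1_loc_lipschitz v)
  (Hv_nonneg : forall t x, 0 <= t -> 0 <= x <= 1 -> 0 <= v (t, x))
  (Hv_pos : forall t, 0 <= t -> 0 < v (t, 0)) :
  exists w : R * R -> R,
    C1_solution v phi a w /\
    (forall w' : R * R -> R, C1_solution v phi a w' ->
       forall t x, 0 <= t -> 0 <= x <= 1 -> w' (t, x) = w (t, x)) /\
    C1_loc_lipschitz w /\
    (forall t, 0 <= t ->
       sup_abs 0 1 (fun x => w (t, x)) <= Rmax (sup_abs 0 t a) (sup_abs 0 1 phi)) /\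
    (forall vmin, 0 < vmin ->
       (forall t x, 0 <= t -> 0 <= x <= 1 -> vmin <= v (t, x)) ->
       (forall t, 0 <= t -> a t = 0) ->
       forall t x, / vmin <= t -> 0 <= x <= 1 -> w (t, x) = 0).
Proof.
assert (Hloc := fun T => exists_rect_solution v phi a da0 dphi0 T Hphi Ha Hcompat0
  Hda0 Hdphi0 Hcompat1 Hv Hv_nonneg Hv_pos).
destruct (functional_choice (fun T (s : (R * R -> R) * (R * R -> R) * R) => 0 < T ->
  let '(w, p, C) := s in
  0 <= C /\ transport_taylor T v w p C /\
    (forall x, 0 <= x <= 1 -> w (0, x) = phi x) /\
    (forall t, 0 <= t <= T -> w (t, 0) = a t) /\
    (forall t x, rect T (t, x) ->
      (exists y, 0 <= y <= 1 /\ w (t, x) = phi y) \/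
      (exists s, 0 <= s <= t /\ w (t, x) = a s)) /\
    (forall vmin, 0 < vmin ->
      (forall t x, 0 <= t -> 0 <= x <= 1 -> vmin <= v (t, x)) ->
      forall t x, rect T (t, x) -> / vmin <= t -> exists s, 0 <= s <= t /\ w (t, x) = a s)))
  as [S HS].
{ intros T; destruct (Rlt_dec 0 T) as [T0|N].
  - destruct (Hloc T T0) as [w [p [C H]]]; exists (w, p, C); intros _; exact H.
  (* For [T <= 0] the relation is vacuous and any triple will do. *)
  - exists (fun _ => 0, fun _ => 0, 0); intros; contradiction. }
clear Hloc.
set (W := fun T => fst (fst (S T))); set (P := fun T => snd (fst (S T))); set (C := fun T => snd (S T)).
assert (HW : forall T, 0 < T -> 0 <= C T /\ transport_taylor T v (W T) (P T) (C T) /\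
    (forall x, 0 <= x <= 1 -> W T (0, x) = phi x) /\
    (forall t, 0 <= t <= T -> W T (t, 0) = a t) /\
    (forall t x, rect T (t, x) ->
      (exists y, 0 <= y <= 1 /\ W T (t, x) = phi y) \/
      (exists s, 0 <= s <= t /\ W T (t, x) = a s)) /\
    (forall vmin, 0 < vmin ->
      (forall t x, 0 <= t -> 0 <= x <= 1 -> vmin <= v (t, x)) ->
      forall t x, rect T (t, x) -> / vmin <= t -> exists s, 0 <= s <= t /\ W T (t, x) = a s)).
{ intros T T0; generalize (HS T T0); unfold W, P, C; destruct (S T) as [[w p] c]; auto. }
clearbody W P C; clear S HS.
assert (Hvr : forall T t x, rect T (t, x) -> 0 <= v (t, x)).
{ intros T t x [R1 R2]; apply Hv_nonneg; [apply R1|exact R2]. }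
assert (HWW : forall T1 T2, 0 < T1 -> T1 <= T2 -> forall t x, rect T1 (t, x) ->
  W T1 (t, x) = W T2 (t, x) /\ P T1 (t, x) = P T2 (t, x)).
{ intros T1 T2 T10 T12.
  destruct (HW T1 T10) as [C10 [H1 [I1 [B1 _]]]].
  destruct (HW T2 ltac:(lra)) as [C20 [H2 [I2 [B2 _]]]].
  apply (transport_taylor_restrict T2 T1) in H2; [|exact T12].
  assert (E : forall q, rect T1 q -> W T1 q = W T2 q).
  { apply (rect_solution_unique T1 v); [exact T10|apply Hvr| | | |].
    - now apply (transport_taylor_solution T1 v _ (P T1) (C T1)).
    - now apply (transport_taylor_solution T1 v _ (P T2) (C T2)).
    - intros x Hx; rewrite I1, I2; auto.
    - intros t Ht; rewrite B1, B2 by lra; auto. }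
  intros t x R; split; [auto|].
  apply (transport_taylor_slope_unique T1 v (W T1) (W T2) _ _ (C T1) (C T2)); auto.
  intros y Hy; apply E; destruct R; split; assumption. }
(* The horizon exceeds the time of the point by 1, which keeps it positive at time 0; by [HWW] any
   other admissible horizon gives the same values. *)
set (w := fun q => W (fst q + 1) q); set (p := fun q => P (fst q + 1) q).
assert (Hw : forall T t x, 0 < T -> rect T (t, x) -> w (t, x) = W T (t, x) /\ p (t, x) = P T (t, x)).
{ intros T t x T0 [R1 R2]; unfold w, p; simpl in *.
  destruct (Rle_dec T (t + 1)).
  - destruct (HWW T (t + 1) T0 ltac:(lra) t x) as [-> ->]; [split; simpl; lra|auto].
  - apply HWW; [lra|lra|split; simpl; lra]. }
clearbody w p.
assert (HT : forall T, 0 < T -> transport_taylor T v w p (C T)).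
{ intros T T0 t x t' x' R R'; destruct (Hw T t x T0 R) as [-> ->].
  destruct (Hw T t' x' T0 R') as [-> _]; now apply (HW T T0). }
assert (HC : forall T, 0 < T -> 0 <= C T) by (intros T T0; apply (HW T T0)).
assert (Lp : forall T, 0 < T -> exists L, 0 <= L /\ rect_lipschitz T L p).
{ intros T T0; assert (C0 := HC T T0); exists (12 * C T * (T + 1)); split; [nra|].
  exact (transport_taylor_lipschitz T v w p (C T) T0 C0 (HT T T0)). }
assert (Lvp : forall T, 0 < T -> exists L, 0 <= L /\ rect_lipschitz T L (fun q => - (v q * p q))).
{ intros T T0; destruct (Lp T T0) as [L [L0 HL]].
  assert (Bp := rect_lipschitz_bounded T L p T0 L0 HL).
  destruct Hv as [vt [vx [HC1 Hlip]]]; destruct (Hlip T T0) as [Hvt Hvx].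
  destruct (C1_rect_estimates v vt vx T HC1 T0 Hvt Hvx) as [K [K0 [Bv [Lv _]]]].
  assert (0 <= Rabs (p (0, 0)) + L * (T + 1)) by (generalize (Rabs_pos (p (0, 0))); nra).
  exists (K * L + K * (Rabs (p (0, 0)) + L * (T + 1))); split; [nra|].
  apply rect_lipschitz_opp_mult; auto; lra. }
assert (HC1 : C1_with w (fun q => - (v q * p q)) p).
{ split; [|split; now apply loc_lipschitz_continuous_on].
  intros [t x] D; assert (D' := D); destruct D' as [D1 D2]; simpl in D1, D2.
  apply (transport_taylor_grad half_strip (t + 1) v w p (C (t + 1))); auto.
  - apply HC; lra.
  - intros t' x' [E1 E2] Hd; simpl in *; apply Rabs_def2 in Hd; split; simpl; lra.
  - apply HT; lra. }
assert (Hinit : forall x, 0 <= x <= 1 -> w (0, x) = phi x).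
{ intros x Hx; destruct (Hw 1 0 x Rlt_0_1) as [-> _]; [split; simpl; lra|].
  now apply (HW 1 Rlt_0_1). }
assert (Hbd : forall t, 0 <= t -> w (t, 0) = a t).
{ intros t Ht; destruct (Hw (t + 1) t 0 ltac:(lra)) as [-> _]; [split; simpl; lra|].
  apply (HW (t + 1)); lra. }
exists w; split; [|split; [|split; [|split]]].
- split; [|split; assumption].
  exists (fun q => - (v q * p q)), p; split; [exact HC1|]; intros; ring.
- intros w' [[wt [wx [[Hg _] Heq]]] [Hi Hb]] t x Ht Hx.
  apply (rect_solution_unique (t + 1) v); [lra|apply Hvr| | | | |split; simpl; lra].
  + exists wt, wx; split.
    * intros [s y] R; apply (is_grad_within_subset half_strip); [exact R|apply rect_half_strip|].
      apply Hg; now apply rect_half_strip in R.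
    * intros s y [R1 R2]; apply Heq; [apply R1|exact R2].
  + apply (transport_taylor_solution (t + 1) v w p (C (t + 1))); [apply HC|apply HT]; lra.
  + intros y Hy; rewrite Hi, Hinit; auto.
  + intros s Hs; rewrite Hb, Hbd; auto; lra.
- exists (fun q => - (v q * p q)), p; split; [exact HC1|]; intros T T0.
  split; apply lipschitz_on_pair_iff; [destruct (Lvp T T0) as [L HL]|destruct (Lp T T0) as [L HL]];
    exists L; exact HL.
- intros t Ht.
  destruct (W2inf_taylor 0 1 phi Rle_0_1 Hphi) as [dphi [Cphi [Cphi0 [Tphi _]]]].
  (* Regularity of [a] is given on [[0, T]] for [T > 0]; the horizon [t + 1] covers the case
     [t = 0]. *)
  destruct (W2inf_taylor 0 (t + 1) a ltac:(lra) (Ha (t + 1) ltac:(lra))) as [da [Ca [Ca0 [Ta _]]]].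
  destruct (taylor_values_bounded _ _ _ _ _ Rle_0_1 Cphi0 Tphi) as [Bphi HBphi].
  destruct (taylor_values_bounded 0 (t + 1) _ _ _ ltac:(lra) Ca0 Ta) as [Ba HBa].
  apply sup_abs_le; [lra|]; intros x Hx.
  assert (R : rect (t + 1) (t, x)) by (split; simpl; [lra|exact Hx]).
  destruct (Hw (t + 1) t x ltac:(lra) R) as [-> _].
  destruct (HW (t + 1) ltac:(lra)) as [_ [_ [_ [_ [Hval _]]]]].
  destruct (Hval t x R) as [[y [Hy ->]]|[s [Hs ->]]].
  + eapply Rle_trans; [|apply Rmax_r]; now apply (le_sup_abs 0 1 phi Bphi).
  + eapply Rle_trans; [|apply Rmax_l]; apply (le_sup_abs 0 t a Ba); [|exact Hs].
    intros r Hr; apply HBa; unfold seg in *; lra.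
- intros vmin Hvm Hvmin Ha0 t x Ht Hx.
  assert (Hi : 0 < / vmin) by now apply Rinv_0_lt_compat.
  assert (R : rect (t + 1) (t, x)) by (split; simpl; lra).
  destruct (Hw (t + 1) t x ltac:(lra) R) as [-> _].
  destruct (HW (t + 1) ltac:(lra)) as [_ [_ [_ [_ [_ Hval]]]]].
  destruct (Hval vmin Hvm Hvmin t x R Ht) as [s [Hs ->]]; apply Ha0; lra.
Qed.
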